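(* Let $\epsilon_n=n^{-1/2}(p+s)^{1/2}(\log p)^{1/2}$, and let $\bm{\Gamma}$ be a (regular) graphical model structure on $p$ variables with $s$ edges, where $p=p_n$, $s=s_n$. If $(p+s)^2\epsilon_n\to0$, that is, if $n^{-1/2}(p+s)^{5/2}(\log p)^{1/2}\to0$, then the error in the Laplace approximation of the posterior probability of $\bm{\Gamma}$ is asymptotically negligible: the ratio of the integral $$\int_{\bm{\Omega}\in\mathcal{M}^+}\exp\{-n\,h(\bm{\Omega})/2\}\prod_{(i,j)\in\mathcal{V}_{\bm{\Gamma}}}d\omega_{ij}$$ to its Laplace approximation $$\exp\{-n\,h(\bm{\Omega}^* )/2\}\,(4\pi/n)^{\#\mathcal{V}_{\bm{\Gamma}}/2}\{\det(\bm{H}_{\bm{\Omega}^*})\}^{-1/2}$$ tends to $1$ in probability as $n\to\infty$.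
   Context: Data: $\bm{X}_1,\ldots,\bm{X}_n$ i.i.d. $\mathrm{N}_p(\bm{0},\bm{\Omega}_0^{-1})$, $\widehat{\bm{\Sigma}}=n^{-1}\sum_{i=1}^n\bm{X}_i\bm{X}_i^T$, with true precision matrix $\bm{\Omega}_0\in\mathcal{U}(\varepsilon_0,s)$, the set of symmetric positive definite $p\times p$ matrices with at most $s$ nonzero entries above the diagonal and all eigenvalues in $[\varepsilon_0,\varepsilon_0^{-1}]$, for a fixed $\varepsilon_0>0$. $\mathcal{M}^+$ is the cone of positive definite symmetric $p\times p$ matrices; $\|\cdot\|_2$ is the Frobenius norm and $\|\cdot\|_{(2,2)}$ the spectral norm. A model is $\bm{\Gamma}=(\gamma_{ij}:1\le i<j\le p)\in\{0,1\}^{\binom p2}$, with $\mathcal{V}_{\bm{\Gamma}}=\{(i,i):1\le i\le p\}\cup\{(i,j):i<j,\gamma_{ij}=1\}$, so that $\#\mathcal{V}_{\bm{\Gamma}}=p+s$ when $\bm{\Gamma}$ has $s$ edges. In the integral, $\bm{\Omega}=(\omega_{ij})$ is symmetric with $\omega_{ij}=0$ whenever $i<j$ and $\gamma_{ij}=0$. For $\lambda>0$, $$h(\bm{\Omega})=-\log\det(\bm{\Omega})+\mathrm{tr}(\widehat{\bm{\Sigma}}\bm{\Omega})+\frac{2\lambda}{n}\sum_{\gamma_{ij}=1}|\omega_{ij}|+\frac{\lambda}{n}\sum_{i=1}^p\omega_{ii},$$ and $\bm{\Omega}^*=(\omega^*_{ij})$ (the graphical lasso solution with penalty $\lambda/n$)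 is the minimizer of $h$ over positive definite matrices with $\omega_{ij}=0$ for $i<j$, $\gamma_{ij}=0$. The model is regular if $\omega^*_{ij}\ne0$ for all $i<j$ with $\gamma_{ij}=1$; the Laplace approximation is considered for regular models. The posterior probability of $\bm{\Gamma}$ is proportional to a factor $C_{\bm{\Gamma}}$ depending on $\bm{\Gamma}$ and the prior only, times the integral in the claim; the approximate posterior probability is obtained by replacing the integral by its Laplace approximation. For $\bm{B}\in\mathcal{M}^+$, $\bm{H}_{\bm{B}}$ is the $\#\mathcal{V}_{\bm{\Gamma}}\times\#\mathcal{V}_{\bm{\Gamma}}$ matrix with $\{(i,j),(l,m)\}$ entry $\mathrm{tr}\{\bm{B}^{-1}\bm{E}_{(i,j)}\bm{B}^{-1}\bm{E}_{(l,m)}\}$ for $(i,j),(l,m)\in\mathcal{V}_{\bm{\Gamma}}$, where $\bm{E}_{(i,j)}$ is the symmetric matrix with entries $1$ at positions $(i,j)$ and $(j,i)$ and $0$ elsewhere. Standing convention of the paper (taken from known results on the graphical lasso): $\|\bm{\Omega}^*-\bm{\Omega}_0\|_2=O_P(\epsilon_n)$ with $\|\bm{\Omega}^*-\bm{\Omega}_0\|_2=o_P(1)$, so that $\|\bm{\Omega}^*\|_{(2,2)}=O_P(1)$ and $\|\bm{\Omega}^{*-1}\|_{(2,2)}=O_P(1)$. *)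

(* Defs.v *)
From HB Require Import structures.
From mathcomp Require Import all_boot all_order all_algebra.
From mathcomp Require Import all_classical all_reals all_analysis.
Set Implicit Arguments.
Unset Strict Implicit.
Unset Printing Implicit Defensive.
Import Order.TTheory GRing.Theory Num.Theory.
Import numFieldNormedType.Exports.
Local Open Scope classical_set_scope.
Local Open Scope ring_scope.

(* Points of R^m are tuples: tuples carry the product sigma-algebra, whereas
   matrices have no measurable structure. *)
Notation Rtuple R m := (m.-tuple (measurableTypeR R)).

Section lebesgue_tuple.
Context {R : realType}.

Definition tuple_cons (m : nat) (x : measurableTypeR R * Rtuple R m) :
  Rtuple R m.+1 := [the m.+1.-tuple _ of x.1 :: x.2].

Lemma measurable_tuple_cons (m : nat) :
  measurable_fun [set: measurableTypeR R * Rtuple R m] (@tuple_cons m).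
Proof. exact: (measurable_cons measurable_fst measurable_snd). Qed.

HB.instance Definition _ (m : nat) :=
  isMeasurableFun.Build _ _ _ _ (@tuple_cons m) (@measurable_tuple_cons m).

Section lebesgue_cons.
Context (m : nat) (mu : {measure set (Rtuple R m) -> \bar R}).

Definition lebesgue_cons : set (Rtuple R m.+1) -> \bar R :=
  pushforward (@lebesgue_measure R \x^ mu)%E (@tuple_cons m).

Let lebesgue_cons0 : lebesgue_cons set0 = 0%E.
Proof. exact: measure0. Qed.

Let lebesgue_cons_ge0 A : (0 <= lebesgue_cons A)%E.
Proof. exact: measure_ge0. Qed.

Let lebesgue_cons_sigma_additive : semi_sigma_additive lebesgue_cons.
Proof. exact: measure_semi_sigma_additive. Qed.

HB.instance Definition _ := isMeasure.Build _ _ _ lebesgue_cons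
  lebesgue_cons0 lebesgue_cons_ge0 lebesgue_cons_sigma_additive.

End lebesgue_cons.

(* Lebesgue measure on R^m, as the m-fold product of lebesgue_measure. *)
Fixpoint lebesgue_tuple (m : nat) : {measure set (Rtuple R m) -> \bar R} :=
  match m with
  | 0 => dirac [tuple]
  | k.+1 => lebesgue_cons (lebesgue_tuple k)
  end.

Lemma lebesgue_tuple_box (m : nat) (A : 'I_m -> set (measurableTypeR R)) :
  (forall i, measurable (A i)) ->
  lebesgue_tuple m [set x | forall i, A i (tnth x i)] =
  (\prod_(i < m) lebesgue_measure (A i))%E.
Proof.
elim: m A => [|m IH] A mA /=.
  rewrite big_ord0 /dirac indicE mem_set //=; by case.
rewrite /lebesgue_cons /pushforward.
rewrite [X in product_measure2 _ _ X](_ : _ =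
  A ord0 `*` [set x | forall i, A (lift ord0 i) (tnth x i)]); last first.
  apply/seteqP; split=> -[a x] /= h.
    split; first by have := h ord0.
    by move=> i; have := h (lift ord0 i); rewrite tnthS.
  case: h => h1 h2 i; case: (unliftP ord0 i) => [j ->|->]; last by rewrite tnth0.
  by rewrite tnthS.
rewrite product_measure2E //.
  by rewrite big_ord_recl; congr (_ * _)%E; apply: IH.
rewrite (_ : [set x | _] =
  \bigcap_(i in [set: 'I_m]) ((fun x : Rtuple R m => tnth x i) @^-1` A (lift ord0 i))); last first.
  by apply/seteqP; split => x /= h i *; exact: h.
apply: fin_bigcap_measurable => // i _.
rewrite -[X in measurable X]setTI; exact: measurable_tnth.
Qed.

End lebesgue_tuple.
Arguments lebesgue_tuple R m : clear implicits.

Section matrices.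
Context {R : realType}.

Definition posdefmx (p : nat) (A : 'M[R]_p) : Prop :=
  A^T = A /\ forall v : 'cV[R]_p, v != 0 -> 0 < (v^T *m A *m v) 0 0.

Definition frobenius_norm (p : nat) (A : 'M[R]_p) : R :=
  Num.sqrt (\sum_i \sum_j A i j ^+ 2).

Definition Emx (p : nat) (ij : 'I_p * 'I_p) : 'M[R]_p :=
  \matrix_(k, l) (((k, l) == ij) || ((l, k) == ij))%:R.

End matrices.

(* The index set {(i, j) : i < j}; a model is the set of its edges. *)
Notation upair p := {ij : 'I_p * 'I_p | (ij.1 < ij.2)%N}.
Notation model p := {set upair p}.

Section graphical_models.
Context {R : realType}.

Implicit Type p : nat.

Definition entry p (A : 'M[R]_p) (e : upair p) : R := A (val e).1 (val e).2.

Definition uclass p (eps0 : R) (s : nat) (Om : 'M[R]_p) : Prop :=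
  [/\ posdefmx Om,
      (#|[pred e : upair p | entry Om e != 0%R]| <= s)%N &
      forall a, eigenvalue Om a -> eps0 <= a <= eps0^-1].

Definition vset p (G : model p) : {set 'I_p * 'I_p} :=
  ([set ij | ij.1 == ij.2] :|: [set val e | e in G])%SET.

(* The symmetric matrix whose entries indexed by vset G are the coordinates of
   x, the other upper-triangular entries being zero. *)
Definition mx_of_coords p (G : model p) (x : Rtuple R #|vset G|) : 'M[R]_p :=
  \sum_(k < #|vset G|) (tnth x k : R) *: Emx (enum_val k).

Definition in_cone p (G : model p) (Om : 'M[R]_p) : Prop :=
  posdefmx Om /\ forall e, e \notin G -> entry Om e = 0.

Definition hfun p (G : model p) (n : nat) (lambda : R) (S Om : 'M[R]_p) : R :=
  - ln (\det Om) + \tr (S *m Om)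
  + 2 * lambda / n%:R * (\sum_(e in G) `|entry Om e|)
  + lambda / n%:R * (\sum_i Om i i).

Definition is_glasso p (G : model p) (n : nat) (lambda : R)
    (S Omstar : 'M[R]_p) : Prop :=
  in_cone G Omstar /\
  forall Om, in_cone G Om -> hfun G n lambda S Omstar <= hfun G n lambda S Om.

Definition regular_model p (G : model p) (Omstar : 'M[R]_p) : Prop :=
  forall e, e \in G -> entry Omstar e != 0.

Definition Hmx p (G : model p) (B : 'M[R]_p) : 'M[R]_(#|vset G|) :=
  \matrix_(a, b) \tr (invmx B *m Emx (enum_val a) *m
                      invmx B *m Emx (enum_val b)).

Definition post_integral p (G : model p) (n : nat) (lambda : R) (S : 'M[R]_p) :
  \bar R :=
  (\int[lebesgue_tuple R #|vset G|]_(x in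
        [set x | posdefmx (mx_of_coords x)])
     (expR (- (n%:R * hfun G n lambda S (mx_of_coords x) / 2)))%:E)%E.

Definition laplace_approx p (G : model p) (n : nat) (lambda : R)
    (S Omstar : 'M[R]_p) : R :=
  expR (- (n%:R * hfun G n lambda S Omstar / 2))
  * (4 * pi / n%:R) `^ (#|vset G|%:R / 2)
  * (\det (Hmx G Omstar)) `^ (- (1 / 2)).

Definition laplace_ratio p (G : model p) (n : nat) (lambda : R)
    (S Omstar : 'M[R]_p) : R :=
  fine (post_integral G n lambda S) / laplace_approx G n lambda S Omstar.

End graphical_models.

Section probability.
Context {R : realType}.

Definition col_of (p : nat) (x : Rtuple R p) : 'cV[R]_p :=
  \col_i (tnth x i : R).

(* Density of N_p(0, Sigma), for Sigma positive definite. *)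
Definition mvnormal_pdf (p : nat) (Sigma : 'M[R]_p) (x : Rtuple R p) : R :=
  expR (- (((col_of x)^T *m invmx Sigma *m col_of x) 0 0 / 2))
  / Num.sqrt ((2 * pi) ^+ p * \det Sigma).

Definition has_mvnormal d (T : measurableType d) (P : probability T R)
    (p : nat) (Sigma : 'M[R]_p) (X : {RV P >-> Rtuple R p}) : Prop :=
  forall A : set (Rtuple R p), measurable A ->
    distribution P X A =
      (\int[lebesgue_tuple R p]_(x in A) (mvnormal_pdf Sigma x)%:E)%E.

(* Taking some of the A i to be the whole space gives the product rule for
   all subfamilies. *)
Definition independent d (T : measurableType d) (P : probability T R)
    d' (T' : measurableType d') (n : nat) (X : 'I_n -> {RV P >-> T'}) : Prop :=
  forall A : 'I_n -> set T', (forall i, measurable (A i)) ->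
    P (\bigcap_i (X i @^-1` A i)) = (\prod_(i < n) P (X i @^-1` A i))%E.

Definition sample_cov (p n : nat) (x : 'I_n -> Rtuple R p) : 'M[R]_p :=
  n%:R^-1 *: \sum_i (col_of (x i) *m (col_of (x i))^T).

(* Stochastic orders for functions Z n on the probability spaces (T n, P n).
   (P n)^* is the outer measure of P n, equal to P n on measurable sets: no
   measurability of Z n is presupposed. *)
Section stochastic_orders.
Context (d : nat -> measure_display) (T : forall n, measurableType (d n)).
Context (P : forall n, probability (T n) R).
Local Open Scope measure_scope.

Definition bounded_in_prob (Z : forall n, T n -> R) (r : nat -> R) : Prop :=
  forall delta : R, 0 < delta -> exists2 M : R, 0 < M &
    \forall n \near \oo,
      ((P n)^* [set w | (M * r n < `|Z n w|)%R] <= delta%:E)%E.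

(* P_n(D n and |Z n - c| > eps) --> 0: when P_n(D n) --> 1 this is convergence
   in probability of Z n to c. *)
Definition cvg_in_prob_on (D : forall n, set (T n)) (Z : forall n, T n -> R)
    (c : R) : Prop :=
  forall eps : R, 0 < eps ->
    (P n)^* (D n `&` [set w | (eps < `|Z n w - c|)%R]) @[n --> \oo] --> 0%E.

Definition cvg_in_prob := cvg_in_prob_on (fun n => [set: T n]).

End stochastic_orders.
End probability.

Definition epsn (R : realType) (p s n : nat) : R :=
  (Num.sqrt n%:R)^-1 * Num.sqrt (p + s)%:R * Num.sqrt (ln p%:R).

(* Main.v *)
(* Write the true integrand at Om* + U, with Om* = V V^T and U = V diag(mu) V^T.
   The log-determinant contributes sum_i (mu_i - ln (1 + mu_i)), which lies
   between q / (2 (1 + max |mu|)) and q / (2 (1 - max |mu|)) for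
   q = sum_i mu_i^2, the quadratic form of H at U.  By minimality of Om* and
   convexity of the penalty, the remaining terms lie between 0 and
   2 lambda sum |U_e| in the exponent, hence are O(lambda s sqrt q); in
   particular the kinks of the penalty near Om* are harmless.  All comparisons
   are therefore with Gaussian integrals of multiples of q, which are computed
   one variable at a time by completing the square.  With r of order
   1 / (p + s), the region sqrt q <= r gives the Laplace approximation up to a
   factor close to 1, and the shells k r <= sqrt q < (k + 1) r are negligible as
   soon as (p + s)^3 / n --> 0.  Everything is deterministic on the event
   |Om* - Om0| <= 1, where the diagonal of Om* is bounded. *)
Require Import Defs.
From HB Require Import structures.
From mathcomp Require Import all_boot all_order all_algebra.
From mathcomp Require Import complex.
From mathcomp Require Import all_classical all_reals all_analysis.
From mathcomp Require Import measurable_realfun.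
From mathcomp Require Import ring lra.
Set Implicit Arguments.
Unset Strict Implicit.
Unset Printing Implicit Defensive.
Import Order.TTheory GRing.Theory Num.Theory.
Import numFieldNormedType.Exports.
Local Open Scope classical_set_scope.
Local Open Scope ring_scope.

(** * Quadratic forms and simultaneous diagonalization *)

Section quadratic_forms.
Context {R : realType}.

Definition qf n (A : 'M[R]_n) (v : 'cV[R]_n) : R := (v^T *m A *m v) 0 0.

Lemma qf_congr n (A W : 'M[R]_n) v : qf (W *m A *m W^T) v = qf A (W^T *m v).
Proof. by rewrite /qf trmx_mul trmxK !mulmxA. Qed.

Lemma qfE n (A : 'M[R]_n) v : qf A v = \sum_i \sum_j A i j * (v i 0 * v j 0).
Proof.
rewrite /qf mxE exchange_big /=; apply: eq_bigr => j _.
rewrite mxE big_distrl /=; apply: eq_bigr => i _.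
by rewrite mxE; ring.
Qed.

Lemma qf_block m (a : R) (S : 'M[R]_m) (x : R) (y : 'cV[R]_m) :
  qf (block_mx a%:M 0 0 S : 'M[R]_(1 + m)) (col_mx x%:M y) = a * x ^+ 2 + qf S y.
Proof.
rewrite /qf -mulmxA mul_block_col !mul0mx addr0 add0r tr_col_mx mul_row_col.
rewrite mxE; congr (_ + _); last by rewrite /qf mulmxA.
by rewrite tr_scalar_mx -!scalar_mxM mxE eqxx mulr1n; ring.
Qed.

Lemma posdef_congr n (A W : 'M[R]_n) : W \in unitmx -> posdefmx A ->
  posdefmx (W *m A *m W^T).
Proof.
move=> Wu [sA pA]; split; first by rewrite !trmx_mul trmxK sA mulmxA.
move=> v v0; rewrite -/(qf _ _) qf_congr; apply: pA.
apply: contraNneq v0 => Wv0.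
by rewrite -[v](mulKmx (x := W^T)) ?unitmx_tr// Wv0 mulmx0.
Qed.

Lemma posdef_congr_inv n (A W : 'M[R]_n) : W \in unitmx ->
  posdefmx (W *m A *m W^T) -> posdefmx A.
Proof.
move=> Wu /(posdef_congr (W := invmx W)); rewrite unitmx_inv => /(_ Wu).
by rewrite -!mulmxA mulKmx// -trmx_mul mulVmx// trmx1 mulmx1.
Qed.

Lemma posdef_block m (a : R) (S : 'M[R]_m) :
  posdefmx (block_mx a%:M 0 0 S : 'M[R]_(1 + m)) -> 0 < a /\ posdefmx S.
Proof.
move=> [sA pA]; split.
  have := pA (col_mx 1%:M 0); rewrite -/(qf _ _) qf_block.
  rewrite /qf mulmx0 mxE addr0 expr1n mulr1; apply.
  rewrite col_mx_eq0 negb_and; apply/orP; left.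
  by apply/eqP => /matrixP/(_ 0 0); rewrite !mxE => /eqP; rewrite oner_eq0.
split.
  by move: sA; rewrite tr_block_mx => /eq_block_mx [].
move=> v v0; have := pA (col_mx 0%:M v); rewrite -/(qf _ _) qf_block.
rewrite expr0n mulr0 add0r; apply.
by rewrite col_mx_eq0 negb_and v0 orbT.
Qed.

(** The lower left block is replaced by the transpose of the upper right one, so this is the usual
    Schur complement when [A] is symmetric. *)
Definition schur_compl m (A : 'M[R]_(1 + m)) : 'M[R]_m :=
  drsubmx A - (A 0 0)^-1 *: ((ursubmx A)^T *m ursubmx A).

Definition schur_l m (A : 'M[R]_(1 + m)) : 'M[R]_(1 + m) :=
  block_mx 1%:M 0 ((A 0 0)^-1 *: (ursubmx A)^T) 1%:M.

Lemma schur_l_unit m (A : 'M[R]_(1 + m)) : schur_l A \in unitmx.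
Proof. by rewrite unitmxE det_lblock !det1 mulr1 unitr1. Qed.

Lemma ulsubmx_scalar m (A : 'M[R]_(1 + m)) : ulsubmx A = (A 0 0)%:M.
Proof.
apply/matrixP => i j; rewrite !ord1 !mxE eqxx mulr1n.
by congr (A _ _); apply/val_inj.
Qed.

Lemma posdef_corner m (A : 'M[R]_(1 + m)) : posdefmx A -> 0 < A 0 0.
Proof.
move=> [_ pA]; have := pA (delta_mx 0 0).
rewrite trmx_delta -mulmxA -colE -rowE !mxE; apply.
by apply/eqP => /matrixP/(_ 0 0); rewrite !mxE => /eqP; rewrite oner_eq0.
Qed.

(** When the first rows of [A] and [B] are proportional, the elimination matrix [schur_l A] clears
    the first row and column of both at once. With [B = A] and [a = 1] this is block elimination for
    a single matrix; in [simul_diag] it splits off a common direction. *)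
Lemma schur_dec m (A B : 'M[R]_(1 + m)) (a : R) :
  posdefmx A -> B^T = B -> row 0 B = a *: row 0 A ->
  B = schur_l A *m block_mx (a * A 0 0)%:M 0 0
     (drsubmx B - (a / A 0 0) *: ((ursubmx A)^T *m ursubmx A)) *m (schur_l A)^T.
Proof.
move=> pA sB rB.
have a0 : A 0 0 != 0 by rewrite gt_eqF// posdef_corner.
have uB : ursubmx B = a *: ursubmx A.
  apply/matrixP => i j; have /matrixP/(_ 0 (rshift 1 j)) := rB.
  rewrite !mxE ord1 => e; congr (_ = _ * _): e;
    by congr fun_of_matrix; apply/val_inj.
have cB : B 0 0 = a * A 0 0 by have /matrixP/(_ 0 0) := rB; rewrite !mxE.
have dB : dlsubmx B = a *: (ursubmx A)^T by rewrite -{1}sB -trmx_ursub uB linearZ.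
rewrite -{1}(submxK B) ulsubmx_scalar cB dB uB.
rewrite /schur_l tr_block_mx !trmx1 trmx0 !mulmx_block.
rewrite !(mul1mx, mulmx1, mul0mx, mulmx0, addr0, add0r).
rewrite linearZ /= trmxK.
congr (block_mx _ _ _ _).
- by rewrite mul_scalar_mx scalerA -mulrA divff// mulr1.
- by rewrite mul_mx_scalar scalerA -mulrA divff// mulr1.
- rewrite mul_mx_scalar scalerA -mulrA divff// mulr1 -scalemxAl -scalemxAr.
  by rewrite scalerA addrC subrK.
Qed.

Lemma schur_decomp m (A : 'M[R]_(1 + m)) : posdefmx A ->
  A = schur_l A *m block_mx (A 0 0)%:M 0 0 (schur_compl A) *m (schur_l A)^T.
Proof.
move=> pA; have [sA _] := pA.
have := @schur_dec m A A 1 pA sA; rewrite scale1r => /(_ erefl).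
by rewrite !mul1r.
Qed.

Lemma posdef_schur m (A : 'M[R]_(1 + m)) : posdefmx A ->
  posdefmx (schur_compl A).
Proof.
move=> pA; have := pA; rewrite {1}(schur_decomp pA).
by move/(posdef_congr_inv (schur_l_unit A))/posdef_block => [].
Qed.

Lemma det_schur m (A : 'M[R]_(1 + m)) : posdefmx A ->
  \det A = A 0 0 * \det (schur_compl A).
Proof.
move=> pA; rewrite {1}(schur_decomp pA) !det_mulmx det_tr det_lblock !det1.
by rewrite det_ublock det_scalar1; ring.
Qed.

(** Completing the square in the first variable: this is what allows a Gaussian integral to be
    computed one coordinate at a time. *)
Lemma qf_schur m (A : 'M[R]_(1 + m)) (x : R) (y : 'cV[R]_m) : posdefmx A ->
  qf A (col_mx x%:M y) =
  A 0 0 * (x + (A 0 0)^-1 * (ursubmx A *m y) 0 0) ^+ 2 + qf (schur_compl A) y.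
Proof.
move=> pA; rewrite {1}(schur_decomp pA) qf_congr -qf_block.
congr qf; rewrite /schur_l tr_block_mx !trmx1 trmx0 mul_block_col.
rewrite !(mul1mx, mul0mx, add0r) linearZ /= trmxK -scalemxAl.
congr col_mx; apply/matrixP => i j.
by rewrite !mxE !ord1 eqxx !mulr1n.
Qed.

Lemma posdef_det_gt0 n (A : 'M[R]_n) : posdefmx A -> 0 < \det A.
Proof.
elim: n A => [A _|n IH A pA]; first by rewrite det_mx00.
rewrite (@det_schur n A)// mulr_gt0 ?IH//; last exact: (@posdef_schur n A).
exact: (@posdef_corner n A).
Qed.

Lemma posdef_unitmx n (A : 'M[R]_n) : posdefmx A -> A \in unitmx.
Proof. by move=> pA; rewrite unitmxE unitfE gt_eqF// posdef_det_gt0. Qed.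

(** * Real and imaginary parts of complex matrices, and a real generalized eigenvector *)

Let Re_mx m n (y : 'M[R[i]]_(m, n)) : 'M[R]_(m, n) := map_mx (@complex.Re R) y.
Let Im_mx m n (y : 'M[R[i]]_(m, n)) : 'M[R]_(m, n) := map_mx (@complex.Im R) y.
Let C_mx m n (A : 'M[R]_(m, n)) : 'M[R[i]]_(m, n) := map_mx (real_complex R) A.

Let Re_sum (I : finType) (F : I -> R[i]) :
  complex.Re (\sum_i F i) = \sum_i complex.Re (F i).
Proof. by apply: (big_morph (@complex.Re R)) => // -[? ?] [? ?]. Qed.

Let Im_sum (I : finType) (F : I -> R[i]) :
  complex.Im (\sum_i F i) = \sum_i complex.Im (F i).
Proof. by apply: (big_morph (@complex.Im R)) => // -[? ?] [? ?]. Qed.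

Let Re_mul m n p (y : 'M[R[i]]_(m, n)) (A : 'M[R]_(n, p)) :
  Re_mx (y *m C_mx A) = Re_mx y *m A.
Proof.
apply/matrixP => i j; rewrite !mxE Re_sum; apply: eq_bigr => k _.
by rewrite !mxE; case: (y i k) => u v /=; ring.
Qed.

Let Im_mul m n p (y : 'M[R[i]]_(m, n)) (A : 'M[R]_(n, p)) :
  Im_mx (y *m C_mx A) = Im_mx y *m A.
Proof.
apply/matrixP => i j; rewrite !mxE Im_sum; apply: eq_bigr => k _.
by rewrite !mxE; case: (y i k) => u v /=; ring.
Qed.

(* The eigenvalue comes from the complex field; it is real since
   x U y^T = y U x^T for the real and imaginary parts x, y of an eigenvector. *)
Lemma real_eigenvector n (Om U : 'M[R]_n.+1) : posdefmx Om -> U^T = U ->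
  exists a (y : 'rV[R]_n.+1), y != 0 /\ y *m U = a *: (y *m Om).
Proof.
move=> pO sU; have [sO posO] := pO; have uO := posdef_unitmx pO.
have [c /eigenvalueP[v vE v0]] :=
  eigenvalue_closed (C_mx (invmx Om *m U)) (ltn0Sn n).
(* A left eigenvector [v] of [invmx Om *m U] becomes, after multiplication by the inverse of [Om], a
   solution of the generalized problem [y U = c y Om]. *)
pose y := v *m C_mx (invmx Om).
have vy : v = y *m C_mx Om by rewrite /y -mulmxA -map_mxM mulVmx// map_mx1 mulmx1.
have yE : y *m C_mx U = c *: (y *m C_mx Om).
  by rewrite -vy -vE /y /C_mx [in RHS]map_mxM mulmxA.
pose x1 := Re_mx y; pose x2 := Im_mx y.
pose al := complex.Re c; pose be := complex.Im c.
have E1 : x1 *m U = al *: (x1 *m Om) - be *: (x2 *m Om).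
  rewrite /x1 /x2 -Re_mul yE -Re_mul -Im_mul; apply/matrixP => i j.
  rewrite !mxE /al /be; set z := \sum_(_ | _) _.
  by case: (c) z => [? ?] [? ?].
have E2 : x2 *m U = al *: (x2 *m Om) + be *: (x1 *m Om).
  rewrite /x1 /x2 -Im_mul yE -Re_mul -Im_mul; apply/matrixP => i j.
  rewrite !mxE /al /be; set z := \sum_(_ | _) _.
  by case: (c) z => [? ?] [? ?].
have x120 : (x1 != 0) || (x2 != 0).
  rewrite -negb_and; apply: contraNN v0 => /andP[/eqP x10 /eqP x20].
  rewrite vy; suff -> : y = 0 by rewrite mul0mx.
  apply/matrixP => i j; move/matrixP/(_ i j): x10; move/matrixP/(_ i j): x20.
  by rewrite !(mxE _ _ i j) => h2 h1; apply/eqP; rewrite eq_complex h1 h2 !eqxx.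
have q0 (x : 'rV[R]_n.+1) : x != 0 -> 0 < (x *m Om *m x^T) 0 0.
  move=> x0; have := posO x^T; rewrite trmxK; apply.
  by apply: contraNneq x0 => x0; rewrite -[x]trmxK x0 trmx0.
have q0' (x : 'rV[R]_n.+1) : 0 <= (x *m Om *m x^T) 0 0.
  have [->|/q0/ltW//] := eqVneq x 0.
  by rewrite !mul0mx mxE.
have sym (B : 'M[R]_n.+1) : B^T = B ->
    (x1 *m B *m x2^T) 0 0 = (x2 *m B *m x1^T) 0 0.
  move=> sB; rewrite -[x1 *m B *m x2^T]trmxK mxE.
  by rewrite !trmx_mul trmxK sB mulmxA.
(* After substituting [E1] and [E2] the [al] terms cancel by symmetry of [Om]. What remains is [be]
   times the sum of the [Om]-forms of [x1] and [x2], which is positive because [x1] and [x2] are not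
   both zero. *)
have := sym _ sU; rewrite E1 E2 mulmxBl mulmxDl -!scalemxAl !mxE.
have := sym _ sO; rewrite !mxE => ->.
move=> /eqP; rewrite -subr_eq0 => /eqP b0.
have be0 : be = 0.
  apply/eqP; move: b0.
  have -> (p q r s t : R) : p - q * r - (p + s * t) = - (q * r + s * t) by ring.
  rewrite -mulrDr => /eqP; rewrite oppr_eq0 mulf_eq0 => /orP[//|].
  move: (q0' x1) (q0' x2) (x120); rewrite !mxE => h1 h2 h3.
  rewrite paddr_eq0// => /andP[/eqP e1 /eqP e2].
  case/orP: h3 => /q0; rewrite !mxE; first by rewrite e2 ltxx.
  by rewrite e1 ltxx.
case/orP: x120 => h; [exists al, x1|exists al, x2]; split => //.
  by rewrite E1 be0 scale0r subr0.
by rewrite E2 be0 scale0r addr0.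
Qed.

Lemma simul_diag n (Om U : 'M[R]_n) : posdefmx Om -> U^T = U ->
  exists (V : 'M[R]_n) (mu : 'rV[R]_n),
    [/\ V \in unitmx, Om = V *m V^T & U = V *m diag_mx mu *m V^T].
Proof.
elim: n Om U => [|n IH] Om U pO sU.
  exists 1%:M, 0; split; first exact: unitmx1.
    by rewrite !thinmx0.
  by rewrite !thinmx0.
have [a [y [y0 yE]]] := real_eigenvector pO sU.
(* Since [y] has rank 1, this invertible matrix has a first row proportional to [y]. *)
pose W : 'M[R]_(1 + n) := row_ebase y.
have Wu : W \in unitmx by exact: row_ebase_unit.
have [c yW] : exists c, y = c *: row 0 W.
  exists (col_ebase y 0 0); rewrite -{1}(mulmx_ebase y).
  rewrite rank_rV y0; apply/rowP => j.
  rewrite !mxE (bigD1 0)//= big1 ?addr0; last first.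
    move=> i i0; rewrite !mxE big_ord1 mxE ord1.
    by move: i0; rewrite -val_eqE /= eq_sym => /negbTE ->; rewrite mulr0 mul0r.
  by rewrite mxE big_ord1 !mxE !eqxx mulr1.
have c0 : c != 0 by apply: contraNneq y0 => c0; rewrite yW c0 scale0r.
have rW : row 0 W *m U = a *: (row 0 W *m Om).
  apply: (scalerI c0); rewrite !scalemxAl -yW yE scalerA mulrC -scalerA.
  by rewrite yW -scalemxAl.
pose O1 : 'M[R]_(1 + n) := W *m Om *m W^T.
pose U1 : 'M[R]_(1 + n) := W *m U *m W^T.
have pO1 : posdefmx O1 by exact: posdef_congr.
have sU1 : U1^T = U1 by rewrite /U1 !trmx_mul trmxK sU mulmxA.
have rU1 : row 0 U1 = a *: row 0 O1.
  by rewrite /U1 /O1 !row_mul rW -scalemxAl.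
have O1E := schur_decomp pO1.
have U1E := schur_dec pO1 sU1 rU1.
move: O1E U1E; set S := schur_compl _; set S' := (_ - _ :> 'M[R]_n).
set L := schur_l _ => O1E U1E.
have sS' : S'^T = S'.
  rewrite /S' linearB /= linearZ /= trmx_mul trmxK; congr (_ - _).
  by rewrite -[in RHS]sU1 trmx_drsub.
have [V' [mu' [V'u SE S'E]]] := IH S S' (posdef_schur pO1) sS'.
have o0 := posdef_corner pO1.
pose K : 'M[R]_(1 + n) := block_mx (Num.sqrt (O1 0 0))%:M 0 0 V'.
have Ku : K \in unitmx.
  rewrite unitmxE /K det_ublock det_scalar1 unitrM -unitmxE V'u andbT.
  by rewrite unitfE gt_eqF// sqrtr_gt0.
have KE : block_mx (O1 0 0)%:M 0 0 S = K *m K^T.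
  rewrite /K tr_block_mx mulmx_block !(mul0mx, mulmx0, addr0, add0r, trmx0) -SE.
  by rewrite tr_scalar_mx -scalar_mxM -expr2 sqr_sqrtr// ltW.
have KE' : block_mx (a * O1 0 0)%:M 0 0 S' =
    K *m diag_mx (row_mx a%:M mu') *m K^T.
  rewrite diag_mx_row /K tr_block_mx !mulmx_block.
  rewrite !(mul0mx, mulmx0, addr0, add0r, trmx0) -S'E.
  have -> : diag_mx (a%:M : 'M[R]_1) = a%:M.
    by apply/matrixP => i j; rewrite !mxE !ord1.
  rewrite tr_scalar_mx -!scalar_mxM; congr (block_mx _%:M _ _ _).
  by rewrite mulrAC mulrC -expr2 sqr_sqrtr// ltW.
exists (invmx W *m L *m K), (row_mx a%:M mu'); split.
- by rewrite !unitmx_mul unitmx_inv Wu schur_l_unit/=.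
- have -> : Om = invmx W *m O1 *m (invmx W)^T.
    by rewrite /O1 -!mulmxA mulKmx// -trmx_mul mulVmx// trmx1 mulmx1.
  by rewrite O1E KE !trmx_mul !mulmxA.
- have -> : U = invmx W *m U1 *m (invmx W)^T.
    by rewrite /U1 -!mulmxA mulKmx// -trmx_mul mulVmx// trmx1 mulmx1.
  by rewrite U1E KE' !trmx_mul !mulmxA.
Qed.

End quadratic_forms.

(** * Gaussian integrals on tuples *)

Section gaussian_integral.
Context {R : realType}.

Lemma measurable_tnthR m (i : 'I_m) :
  measurable_fun [set: Rtuple R m] (fun x => tnth x i : R).
Proof. exact: measurable_tnth. Qed.

Lemma measurable_qf m (A : 'M[R]_m) (c : 'cV[R]_m) :
  measurable_fun [set: Rtuple R m] (fun x => qf A (col_of x - c)).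
Proof.
under eq_fun do rewrite qfE.
apply: measurable_sum => i; apply: measurable_sum => j.
have mcol k : measurable_fun [set: Rtuple R m] (fun x => (col_of x - c) k 0).
  under eq_fun do rewrite !mxE.
  by apply: measurable_funB; [exact: measurable_tnthR|exact: measurable_cst].
by apply: measurable_funM; [exact: measurable_cst|exact: measurable_funM].
Qed.

Lemma measurable_expR_qf m (A : 'M[R]_m) (c : 'cV[R]_m) :
  measurable_fun [set: Rtuple R m]
    (fun x => (expR (- qf A (col_of x - c)))%:E).
Proof.
apply/measurable_EFinP; apply: measurableT_comp => //.
by apply: measurableT_comp => //; exact: measurable_qf.
Qed.

Lemma lebesgue_tuple_sigma_finite m :
  sigma_finite [set: Rtuple R m] (lebesgue_tuple R m).
Proof.
pose I (k : nat) : set (measurableTypeR R) := `[(- k%:R)%R, k%:R]%classic.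
have mI k : measurable (I k) by exact: measurable_itv.
exists (fun k => [set x : Rtuple R m | forall i, I k (tnth x i)]).
  apply/seteqP; split => // x _.
  pose M := \sum_(i < m) `|tnth x i : R|.
  exists (Num.bound M) => //= i; rewrite /I /= in_itv /= -ler_norml.
  apply: (@le_trans _ _ M); last first.
    have M0 : 0 <= M by exact: sumr_ge0.
    by rewrite ltW//; exact: archi_boundP.
  by rewrite /M (bigD1 i)//= lerDl sumr_ge0.
move=> k; split.
  rewrite (_ : [set x | _] =
    \bigcap_(i in [set: 'I_m]) ((fun x : Rtuple R m => tnth x i) @^-1` I k)).
    apply: fin_bigcap_measurable => // i _.
    rewrite -[X in measurable X]setTI; exact: measurable_tnth.
  by apply/seteqP; split => x /= h i *; exact: h.
rewrite (@lebesgue_tuple_box R m (fun=> I k))// big_const_ord.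
elim: m => [|m IH] /=; first by rewrite ltry.
rewrite lte_mul_pinfty//.
rewrite ge0_fin_numE ?measure_ge0// /I lebesgue_measure_itv/=.
by case: ifP => _; rewrite ?ltry// -EFinD ltry.
Qed.

Section tonelli_cons.
Context (m : nat) (mu0 : {measure set (Rtuple R m) -> \bar R}).
Hypothesis mu0_sigma_finite : sigma_finite [set: Rtuple R m] mu0.

(** An alias of [mu0] to which the sigma-finiteness hypothesis can be attached as a structure. *)
Let mu : set (Rtuple R m) -> \bar R := mu0.

HB.instance Definition _ := Measure.on mu.

HB.instance Definition _ :=
  Measure_isSigmaFinite.Build _ _ _ mu mu0_sigma_finite.

(** Tonelli, with the first coordinate innermost. [lebesgue_cons] is built from [\x^] whereas
    [fubini_tonelli2] concerns [\x]; both products agree on rectangles, hence are equal by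
    uniqueness. *)
Lemma integral_lebesgue_cons (f : Rtuple R m.+1 -> \bar R) :
  measurable_fun [set: Rtuple R m.+1] f -> (forall x, 0 <= f x)%E ->
  (\int[lebesgue_cons mu0]_x f x =
   \int[mu0]_y \int[@lebesgue_measure R]_x f (tuple_cons (x, y)))%E.
Proof.
move=> mf f0.
have mc := @measurable_tuple_cons R m.
transitivity (\int[pushforward (@lebesgue_measure R \x^ mu) (@tuple_cons R m)]_x f x)%E.
  by [].
rewrite ge0_integral_pushforward// preimage_setT.
transitivity (\int[@lebesgue_measure R \x mu]_x (f \o @tuple_cons R m) x)%E.
  apply/esym/eq_measure_integral => B mB _.
  by apply: product_measure_unique => //= *; rewrite product_measure2E.
rewrite fubini_tonelli2//; first exact: measurableT_comp.
by move=> x; exact: f0.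
Qed.

End tonelli_cons.

Lemma integral_lebesgue_tupleS m (f : Rtuple R m.+1 -> \bar R) :
  measurable_fun [set: Rtuple R m.+1] f -> (forall x, 0 <= f x)%E ->
  (\int[lebesgue_tuple R m.+1]_x f x =
   \int[lebesgue_tuple R m]_y \int[@lebesgue_measure R]_x f (tuple_cons (x, y)))%E.
Proof. exact: (integral_lebesgue_cons (lebesgue_tuple_sigma_finite m)). Qed.

(** This is the normalization of the normal density with mean [- c] and variance [1 / (2 a)]. *)
Lemma integral_gauss1 (a c : R) : 0 < a ->
  (\int[@lebesgue_measure R]_x (expR (- (a * (x + c) ^+ 2)))%:E =
   (Num.sqrt (pi / a))%:E)%E.
Proof.
move=> a0; pose s : R := Num.sqrt ((2 * a)^-1).
have s2 : s ^+ 2 = (2 * a)^-1 by rewrite sqr_sqrtr// invr_ge0 mulr_ge0// ltW.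
have s0 : s != 0 by rewrite gt_eqF// sqrtr_gt0 invr_gt0 mulr_gt0.
have pk : Num.sqrt (pi / a) = (normal_peak s)^-1.
  rewrite /normal_peak invrK s2; congr Num.sqrt.
  by rewrite -mulr_natr; field; rewrite gt_eqF.
have := integral_normal_pdf (- c) s; rewrite normal_pdfE//.
under eq_integral do rewrite EFinM.
rewrite ge0_integralZl_EFin//=; last 3 first.
- by move=> x _; rewrite lee_fin normal_fun_ge0.
- by apply/measurable_EFinP; exact: measurable_normal_fun.
- exact: normal_peak_ge0.
have -> : (\int[@lebesgue_measure R]_x (normal_fun (- c) s x)%:E =
    \int[@lebesgue_measure R]_x (expR (- (a * (x + c) ^+ 2)))%:E)%E.
  apply: eq_integral => x _; rewrite /normal_fun; congr (expR _)%:E.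
  rewrite s2 opprK -mulr_natr; field; by rewrite gt_eqF.
move=> h.
have p0 := normal_peak_gt0 s0.
rewrite pk -[LHS]mul1e -[1%E](_ : (normal_peak s)^-1%:E * (normal_peak s)%:E = 1)%E.
  by rewrite -muleA h mule1.
by rewrite -EFinM mulVf// gt_eqF.
Qed.

(** The exponent has no factor 1/2, hence [pi] instead of [2 pi]. By [qf_schur] the integral over
    the first coordinate is one-dimensional and leaves the same problem for the Schur complement; in
    dimension 0 the measure is a unit point mass. *)
Lemma integral_gauss m (A : 'M[R]_m) (c : 'cV[R]_m) : posdefmx A ->
  (\int[lebesgue_tuple R m]_x (expR (- qf A (col_of x - c)))%:E =
   (Num.sqrt (pi ^+ m / \det A))%:E)%E.
Proof.
elim: m A c => [|m IH] A c pA.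
  rewrite /= integral_dirac//; last exact: measurable_expR_qf.
  rewrite diracE mem_set// mul1e /qf mxE big_ord0 oppr0 expR0.
  by rewrite det_mx00 expr0 divr1 sqrtr1.
rewrite (@integral_lebesgue_tupleS m (fun x => (expR (- qf A (col_of x - c)))%:E)); last 2 first.
- exact: measurable_expR_qf.
- by move=> x; rewrite lee_fin expR_ge0.
have A0 := posdef_corner (m := m) pA.
pose c' : 'cV[R]_m := dsubmx (c : 'cV[R]_(1 + m)).
have colE x y : col_of (tuple_cons (x, y)) - c =
    col_mx (x - c 0 0)%:M (col_of y - c') :> 'cV[R]_(1 + m).
  apply/matrixP => i j; rewrite ord1 !mxE; case: splitP => k ik.
    have -> : i = ord0 by apply/val_inj => /=; rewrite ik ord1.
    by rewrite !mxE tnth0 ord1 eqxx mulr1n.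
  have -> : i = rshift 1 k by apply/val_inj.
  rewrite !mxE; congr (_ - _).
  have -> : rshift 1 k = lift ord0 k by apply/val_inj.
  by rewrite tnthS.
have inner y : (\int[@lebesgue_measure R]_x
      (expR (- qf A (col_of (tuple_cons (x, y)) - c)))%:E =
    (expR (- qf (schur_compl (A : 'M[R]_(1 + m))) (col_of y - c')))%:E *
    (Num.sqrt (pi / A 0 0))%:E)%E.
  under eq_integral => x _.
    rewrite colE (qf_schur (m := m))// opprD expRD EFinM muleC -addrA. over.
  rewrite ge0_integralZl_EFin ?expR_ge0//.
  - by rewrite integral_gauss1.
  - apply/measurable_EFinP; apply: measurableT_comp => //.
    apply: measurableT_comp => //; apply: measurable_funM => //.
    by apply: measurable_funX; apply: measurable_funD.
under eq_integral => y _ do rewrite inner.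
rewrite ge0_integralZr ?lee_fin ?sqrtr_ge0//; last first.
  exact: measurable_expR_qf.
rewrite IH; last exact: (posdef_schur (m := m)).
have S0 := posdef_det_gt0 (posdef_schur (m := m) pA).
rewrite -EFinM -sqrtrM; last by rewrite divr_ge0 ?exprn_ge0 ?pi_ge0// ltW.
rewrite (det_schur (m := m) pA) exprS; congr (Num.sqrt _)%:E.
by field; rewrite !gt_eqF.
Qed.

End gaussian_integral.

(** * The second-order remainder of log det *)

Section log_remainder.
Context {R : realType}.

Lemma is_derive_ge0_le (f df : R -> R) (a b : R) : a <= b ->
  (forall x, a <= x <= b -> is_derive x 1 f (df x)) ->
  (forall x, a <= x <= b -> 0 <= df x) -> f a <= f b.
Proof.
move=> ab Hf df0.
have [||c cab] := @MVT_segment R f df a b ab.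
- move=> x; rewrite in_itv /= => /andP[xa xb]; apply: Hf.
  by rewrite !ltW.
- apply: derivable_within_continuous => x; rewrite in_itv /= => xab.
  by have := Hf _ xab; move=> ?; exact: ex_derive.
- move=> h; rewrite -subr_ge0 h mulr_ge0 ?subr_ge0//; apply: df0.
  by rewrite in_itv /= in cab.
Qed.

(** The contribution of one eigenvalue of [U] relative to [Om] to the remainder of [- ln det] after
    its linear term. *)
Definition lnrem (m : R) : R := m - ln (1 + m).

(** Both functions vanish at 1 and have as derivative a square over a positive quantity, so their
    sign on each side of 1 is known. At [x = 1 + m], [g1] compares [lnrem m] with [m ^ 2 / 2] and
    [g2] compares it with [m ^ 2 / (2 (1 + m))]; which of the two is the upper bound depends on the
    sign of [m]. *)
Let g1 (x : R) : R := ln x - (x - 1) + (x - 1) ^+ 2 / 2.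
Let g2 (x : R) : R := x / 2 - x^-1 / 2 - ln x.

Let g1_mono (a b : R) : 0 < a -> a <= b -> g1 a <= g1 b.
Proof.
move=> a0 ab; apply: (@is_derive_ge0_le _ (fun x => x^-1 - 1 + (x - 1))) => //.
- move=> x /andP[ax _]; have x0 := lt_le_trans a0 ax.
  have ? := is_derive1_ln x0.
  apply: is_derive_eq; rewrite /GRing.scale /=.
  by field; rewrite gt_eqF.
- move=> x /andP[ax _]; have x0 := lt_le_trans a0 ax.
  have -> : x^-1 - 1 + (x - 1) = (x - 1) ^+ 2 / x by field; rewrite gt_eqF.
  by rewrite divr_ge0 ?sqr_ge0 ?ltW.
Qed.

Let g2_mono (a b : R) : 0 < a -> a <= b -> g2 a <= g2 b.
Proof.
move=> a0 ab; apply: (@is_derive_ge0_le _ (fun x => 2^-1 + x^-2 / 2 - x^-1)) => //.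
- move=> x /andP[ax _]; have x0 := lt_le_trans a0 ax.
  have ? := is_derive1_ln x0.
  have xn0 : x != 0 by rewrite gt_eqF.
  have ? := @is_deriveV R id x 1 1 xn0 (is_derive_id x 1).
  apply: is_derive_eq; rewrite /GRing.scale /=.
  by field; rewrite gt_eqF.
- move=> x /andP[ax _]; have x0 := lt_le_trans a0 ax.
  have -> : 2^-1 + x^-2 / 2 - x^-1 = (1 - x^-1) ^+ 2 / 2.
    by field; rewrite gt_eqF.
  by rewrite divr_ge0 ?sqr_ge0.
Qed.

Let g11 : g1 1 = 0. Proof. by rewrite /g1 ln1 subrr expr0n /= mul0r subrr addr0. Qed.
Let g21 : g2 1 = 0. Proof. by rewrite /g2 ln1 invr1; lra. Qed.

Lemma lnrem_ge (m : R) : -1 < m -> m ^+ 2 / (2 * (1 + `|m|)) <= lnrem m.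
Proof.
move=> m1; have m10 : 0 < 1 + m by lra.
have [m0|m0] := leP 0 m.
  have := @g2_mono 1 (1 + m); rewrite g21 /g2 ltr01 => /(_ erefl).
  have -> : 1 <= 1 + m by lra.
  move=> /(_ erefl) h; rewrite ger0_norm// /lnrem.
  have -> : m ^+ 2 / (2 * (1 + m)) = m - ((1 + m) / 2 - (1 + m)^-1 / 2).
    by field; rewrite gt_eqF.
  lra.
have := @g1_mono (1 + m) 1; rewrite g11 /g1 m10 => /(_ erefl).
have -> : 1 + m <= 1 by lra.
move=> /(_ erefl) h; apply: (@le_trans _ _ (m ^+ 2 / 2)).
  apply: ler_wpM2l; first exact: sqr_ge0.
  by rewrite lef_pV2 ?posrE ?mulr_gt0// ?ltr_wpDr// ler_pMr// lerDl.
rewrite /lnrem; move: h; have -> : 1 + m - 1 = m by ring.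
lra.
Qed.

Lemma lnrem_le (m : R) : `|m| < 1 -> lnrem m <= m ^+ 2 / (2 * (1 - `|m|)).
Proof.
move=> m1; have m10 : 0 < 1 + m by move: m1; rewrite ltr_norml; lra.
have [m0|m0] := leP 0 m.
  have := @g1_mono 1 (1 + m); rewrite g11 /g1 ltr01 => /(_ erefl).
  have -> : 1 <= 1 + m by lra.
  move=> /(_ erefl) h; apply: (@le_trans _ _ (m ^+ 2 / 2)).
    rewrite /lnrem; move: h; have -> : 1 + m - 1 = m by ring.
    lra.
  apply: ler_wpM2l; first exact: sqr_ge0.
  rewrite lef_pV2 ?posrE ?mulr_gt0// ?subr_gt0//.
  by rewrite ler_piMr// gerBl.
have := @g2_mono (1 + m) 1; rewrite g21 /g2 m10 => /(_ erefl).
have -> : 1 + m <= 1 by lra.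
move=> /(_ erefl) h; rewrite ltr0_norm// opprK /lnrem.
have -> : m ^+ 2 / (2 * (1 + m)) = m - ((1 + m) / 2 - (1 + m)^-1 / 2).
  by field; rewrite gt_eqF.
lra.
Qed.

End log_remainder.

(** * Positivity, determinant, traces and entries in simultaneously diagonal form *)

Section simultaneous_diagonalization.
Context {R : realType} (n : nat) (V : 'M[R]_n) (mu : 'rV[R]_n).
Hypothesis Vu : V \in unitmx.
Let Om := V *m V^T.
Let U := V *m diag_mx mu *m V^T.

Let addE : Om + U = V *m diag_mx (const_mx 1 + mu) *m V^T.
Proof. by rewrite linearD /= diag_const_mx mulmxDr mulmx1 mulmxDl. Qed.

Lemma diag_qf (d : 'rV[R]_n) v :
  qf (V *m diag_mx d *m V^T) v = \sum_i d 0 i * ((V^T *m v) i 0) ^+ 2.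
Proof.
rewrite qf_congr /qf mul_mx_diag mxE; apply: eq_bigr => i _.
by rewrite !mxE; ring.
Qed.

Lemma diag_posdef : posdefmx (Om + U) <-> forall i, -1 < mu 0 i.
Proof.
split=> [[_ h] i|h].
  have v0 : invmx V^T *m delta_mx i 0 != 0 :> 'cV_n.
    apply/eqP => /(congr1 (mulmx V^T)).
    rewrite mulKVmx ?unitmx_tr// mulmx0 => /matrixP/(_ i 0).
    by rewrite !mxE !eqxx => /eqP; rewrite oner_eq0.
  have := h _ v0; rewrite -/(qf _ _) addE diag_qf mulKVmx ?unitmx_tr//.
  rewrite (bigD1 i)//= big1 => [|j ji]; rewrite !mxE.
    by rewrite !eqxx expr1n mulr1 addr0; lra.
  by rewrite (negbTE ji) expr0n mulr0.
split; first by rewrite addE !trmx_mul trmxK tr_diag_mx mulmxA.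
move=> v v0; rewrite -/(qf _ _) addE diag_qf.
have [i wi] : exists i, (V^T *m v) i 0 != 0.
  apply/existsP; apply: contraNT v0 => /existsPn h0.
  rewrite -[v](mulKmx (x := V^T)) ?unitmx_tr//.
  suff -> : V^T *m v = 0 by rewrite mulmx0.
  by apply/matrixP => i j; rewrite ord1 [RHS]mxE; apply/eqP/negPn/h0.
have p j : 0 < (const_mx 1 + mu) 0 j by rewrite !mxE; have := h j; lra.
rewrite (bigD1 i)//= ltr_pwDl//.
  by rewrite mulr_gt0// exprn_even_gt0.
by apply: sumr_ge0 => j _; rewrite mulr_ge0 ?sqr_ge0// ltW.
Qed.

Lemma diag_det : \det (Om + U) = \det Om * \prod_i (1 + mu 0 i).
Proof.
rewrite addE !det_mulmx det_diag mulrAC; congr (_ * _).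
by apply: eq_bigr => i _; rewrite !mxE.
Qed.

Let invOmU : invmx Om *m U = invmx V^T *m diag_mx mu *m V^T.
Proof.
have h : Om *m (invmx V^T *m diag_mx mu *m V^T) = U.
  by rewrite /Om /U -!mulmxA mulKVmx ?unitmx_tr.
by rewrite -h mulKmx// unitmx_mul unitmx_tr Vu.
Qed.

Lemma diag_tr : \tr (invmx Om *m U) = \sum_i mu 0 i.
Proof. by rewrite invOmU -mulmxA mxtrace_mulC mulmxK ?unitmx_tr// mxtrace_diag. Qed.

(** Together with [qf_Hmx], this identifies the quadratic form of [Hmx] with the sum of squared
    relative eigenvalues. *)
Lemma diag_tr2 :
  \tr (invmx Om *m U *m invmx Om *m U) = \sum_i mu 0 i ^+ 2.
Proof.
rewrite -(mulmxA (_ *m U)) invOmU mulmxA.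
rewrite -(mulmxA (_ *m _) V^T) -(mulmxA _ (diag_mx mu)) (mulmxA V^T).
rewrite mulmxV ?unitmx_tr// mul1mx.
rewrite mxtrace_mulC !mulmxA mulmxV ?unitmx_tr// mul1mx.
rewrite mulmx_diag mxtrace_diag; apply: eq_bigr => i _.
by rewrite !mxE expr2.
Qed.

(** Each [|mu k|] is at most the square root, and [|V i k V j k|] is at most the mean of the two
    squares, which sum to diagonal entries of [Om]. This turns the penalty into a multiple of
    [sqrt q]. *)
Lemma diag_entry_le i j :
  `|U i j| <= Num.sqrt (\sum_k mu 0 k ^+ 2) * ((Om i i + Om j j) / 2).
Proof.
set q := Num.sqrt _.
have q0 : 0 <= q by exact: sqrtr_ge0.
have muq k : `|mu 0 k| <= q.
  rewrite -sqrtr_sqr ler_sqrt ?sumr_ge0// => [|l _]; last exact: sqr_ge0.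
  by rewrite (bigD1 k)//= lerDl sumr_ge0// => l _; exact: sqr_ge0.
have -> : U i j = \sum_k V i k * mu 0 k * V j k.
  by rewrite /U mul_mx_diag mxE; apply: eq_bigr => k _; rewrite !mxE.
have OmE a : Om a a = \sum_k V a k ^+ 2.
  by rewrite /Om mxE; apply: eq_bigr => k _; rewrite !mxE expr2.
rewrite !OmE -big_split /= mulr_suml mulr_sumr.
apply: (le_trans (ler_norm_sum _ _ _)); apply: ler_sum => k _.
rewrite mulrAC normrM mulrC; apply: ler_pM => //.
have := sqr_ge0 (`|V i k| - `|V j k|).
rewrite normrM -(real_normK (num_real (V i k))) -(real_normK (num_real (V j k))).
by rewrite sqrrB; lra.
Qed.

Lemma ln_diag_det : 0 < \det Om -> (forall i, -1 < mu 0 i) ->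
  - ln (\det (Om + U)) = - ln (\det Om) - \tr (invmx Om *m U)
     + \sum_i lnrem (mu 0 i).
Proof.
move=> d0 h; rewrite diag_det diag_tr.
have p i : 0 < 1 + mu 0 i by have := h i; lra.
have -> : ln (\det Om * \prod_i (1 + mu 0 i)) =
    ln (\det Om) + \sum_i ln (1 + mu 0 i).
  rewrite lnM ?posrE ?prodr_gt0//; congr (_ + _).
  suff [] : ln (\prod_i (1 + mu 0 i)) = \sum_i ln (1 + mu 0 i) /\
            0 < \prod_i (1 + mu 0 i) by [].
  apply: (big_ind2 (fun x y => ln x = y /\ 0 < x)) => [|x1 x2 y1 y2|i _].
  - by rewrite ln1.
  - by move=> [<- x0] [<- y0]; rewrite lnM ?posrE// mulr_gt0.
  - by [].
by rewrite /lnrem sumrB; ring.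
Qed.

End simultaneous_diagonalization.

(** [simul_diag] against the identity is the spectral theorem; a diagonal entry is then an average
    of eigenvalues with weights [V i k ^ 2] of sum 1. *)
Lemma eigen_diag_le (R : realType) n (Om : 'M[R]_n) (C : R) i : Om^T = Om ->
  (forall a, eigenvalue Om a -> a <= C) -> Om i i <= C.
Proof.
move=> sO h.
have p1 : posdefmx (1%:M : 'M[R]_n).
  split=> [|v v0]; first exact: trmx1.
  rewrite mulmx1 mxE.
  have [j vj] : exists j, v j 0 != 0.
    apply/existsP; apply: contraNT v0 => /existsPn h0.
    by apply/eqP/matrixP => k l; rewrite ord1 [RHS]mxE; apply/eqP/negPn/h0.
  rewrite (bigD1 j)//= !mxE ltr_pwDl//.
    by rewrite -expr2 exprn_even_gt0.
  by apply: sumr_ge0 => k _; rewrite !mxE -expr2 sqr_ge0.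
have [V [mu [Vu V1 OE]]] := simul_diag p1 sO.
have VV : V^T *m V = 1%:M by rewrite (mulmx1C (esym V1)).
have muC k : mu 0 k <= C.
  apply: h; apply/eigenvalueP; exists (row k V^T).
    rewrite OE -row_mul !mulmxA VV mul1mx row_mul row_diag_mx -scalemxAl.
    by rewrite -rowE.
  apply/eqP => /(congr1 (fun w => (w *m V) 0 k)).
  rewrite -row_mul VV mul0mx !mxE eqxx => /eqP.
  by rewrite oner_eq0.
have -> : Om i i = \sum_k V i k ^+ 2 * mu 0 k.
  by rewrite OE mul_mx_diag mxE; apply: eq_bigr => k _; rewrite !mxE; ring.
have <- : \sum_k V i k ^+ 2 * C = C.
  rewrite -mulr_suml; have /matrixP/(_ i i) := V1.
  rewrite !mxE eqxx; under eq_bigr do rewrite mxE -expr2.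
  by move=> <-; rewrite mul1r.
by apply: ler_sum => k _; apply: ler_wpM2l => //; exact: sqr_ge0.
Qed.

(** * Coordinates of sparse matrices and the graphical lasso *)

Section coordinates.
Context {R : realType} (p : nat) (G : model p).
Implicit Types (v : 'cV[R]_#|vset G|) (A B Om : 'M[R]_p).

(** The column-vector version of [mx_of_coords], on which linear algebra is available. *)
Definition coord_mx v : 'M[R]_p := \sum_k v k 0 *: Emx (enum_val k).

Definition mx_coords A : 'cV[R]_#|vset G| :=
  \col_k A (enum_val k).1 (enum_val k).2.

Lemma mx_of_coordsE (x : Rtuple R #|vset G|) :
  mx_of_coords x = coord_mx (col_of x).
Proof. by apply: eq_bigr => k _; rewrite mxE. Qed.

Lemma coord_mxB u v : coord_mx (u - v) = coord_mx u - coord_mx v.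
Proof. by rewrite -sumrB; apply: eq_bigr => k _; rewrite !mxE scalerBl. Qed.

Lemma tr_Emx (ij : 'I_p * 'I_p) : (Emx ij)^T = Emx ij :> 'M[R]_p.
Proof. by apply/matrixP => k l; rewrite !mxE orbC. Qed.

Lemma tr_coord_mx v : (coord_mx v)^T = coord_mx v.
Proof.
by rewrite linear_sum; apply: eq_bigr => k _; rewrite linearZ /= tr_Emx.
Qed.

Lemma vset_leq ij : ij \in vset G -> (ij.1 <= ij.2)%N.
Proof.
rewrite /vset !inE => /orP[/eqP -> //|/imsetP[e _ ->]].
exact: ltnW (valP e).
Qed.

(** Index pairs are ordered, so a pair and its transpose both lie in [vset G] only on the diagonal;
    hence reading off entries is dual to the matrices [Emx]. *)
Lemma Emx_enum (k l : 'I_#|vset G|) :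
  Emx (enum_val l) (enum_val k).1 (enum_val k).2 = (k == l)%:R :> R.
Proof.
rewrite mxE -surjective_pairing; congr (_%:R); congr nat_of_bool.
rewrite (inj_eq enum_val_inj); have [//|/= kl] := eqVneq k l.
apply/negbTE; apply: contraNneq kl => e.
have := vset_leq (enum_valP k); have := vset_leq (enum_valP l).
rewrite -e /= => h1 h2; apply/eqP/enum_val_inj.
rewrite -e [LHS]surjective_pairing.
by have /val_inj -> : (enum_val k).1 = (enum_val k).2 :> nat
  by apply/eqP; rewrite eqn_leq h1 h2.
Qed.

Lemma coord_mxK v : mx_coords (coord_mx v) = v.
Proof.
apply/matrixP => k j; rewrite ord1 mxE summxE (bigD1 k)//= mxE Emx_enum eqxx.
rewrite mulr1 big1 ?addr0// => l lk.
by rewrite mxE Emx_enum eq_sym (negbTE lk) mulr0.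
Qed.

Lemma coord_mx_notin v i j : (i, j) \notin vset G -> (j, i) \notin vset G ->
  coord_mx v i j = 0.
Proof.
move=> h1 h2; rewrite summxE big1// => k _; rewrite !mxE.
case: eqP => [e|_]; first by rewrite e enum_valP in h1.
case: eqP => [e|_]; first by rewrite e enum_valP in h2.
by rewrite mulr0.
Qed.

Lemma upair_notin_vset (e : upair p) : e \notin G ->
  (val e \notin vset G) && (((val e).2, (val e).1) \notin vset G).
Proof.
move=> eG; have e12 := valP e; apply/andP; split.
  rewrite !inE negb_or -val_eqE neq_ltn e12 /=.
  by rewrite (mem_imset _ _ val_inj).
by apply/negP => /vset_leq /=; rewrite leqNgt e12.
Qed.

Lemma coord_mx_entry0 v e : e \notin G -> entry (coord_mx v) e = 0.
Proof.
move=> /upair_notin_vset/andP[h1 h2]; apply: coord_mx_notin => //.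
by rewrite -surjective_pairing.
Qed.

Lemma mx_coordsK Om : Om^T = Om -> (forall e, e \notin G -> entry Om e = 0) ->
  coord_mx (mx_coords Om) = Om.
Proof.
move=> sO Om0; set M := coord_mx _.
have sM : M^T = M by exact: tr_coord_mx.
have inE' i j : (i, j) \in vset G -> M i j = Om i j.
  move=> ij; have := coord_mxK (mx_coords Om).
  move=> /matrixP/(_ (enum_rank_in ij (i, j)) 0).
  by rewrite !mxE enum_rankK_in.
have symE (A : 'M[R]_p) i j : A^T = A -> A i j = A j i.
  by move=> sA; rewrite -[in LHS]sA mxE.
suff ltE (i j : 'I_p) : (i < j)%N -> M i j = Om i j.
  apply/matrixP => i j; case: (ltngtP i j) => [/ltE//|ji|/val_inj ->].
    by rewrite symE// [RHS]symE// ltE.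
  by apply: inE'; rewrite !inE eqxx.
move=> ij; pose e : upair p := exist _ (i, j) ij.
have [eG|eG] := boolP (e \in G).
  by apply: inE'; rewrite inE; apply/orP; right; apply/imsetP; exists e.
by rewrite -[RHS]/(entry Om e) Om0// -[LHS]/(entry M e) coord_mx_entry0.
Qed.

Lemma qf_Hmx B v : qf (Hmx G B) v =
  \tr (invmx B *m coord_mx v *m invmx B *m coord_mx v).
Proof.
rewrite qfE {2}/coord_mx mulmx_sumr raddf_sum /= exchange_big /=.
apply: eq_bigr => j _; rewrite -scalemxAr mxtraceZ.
rewrite /coord_mx mulmx_sumr !mulmx_suml raddf_sum /= mulr_sumr.
apply: eq_bigr => i _; rewrite -scalemxAr -!scalemxAl mxtraceZ mxE.
ring.
Qed.

Lemma tr_Hmx B : (Hmx G B)^T = Hmx G B.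
Proof.
apply/matrixP => i j; rewrite !mxE.
by rewrite -mulmxA mxtrace_mulC !mulmxA.
Qed.

(** The form at [v] is the sum of squared relative eigenvalues of [coord_mx v]; it vanishes only if
    that matrix is zero, and [coord_mx] is injective. *)
Lemma posdef_Hmx B : posdefmx B -> posdefmx (Hmx G B).
Proof.
move=> pB; split; first exact: tr_Hmx.
move=> v v0; rewrite -/(qf _ _) qf_Hmx.
have [V [mu [Vu BE UE]]] := simul_diag pB (tr_coord_mx v).
rewrite UE {1 2}BE diag_tr2// lt0r sumr_ge0 ?andbT => [|i _]; last exact: sqr_ge0.
apply: contraNneq v0 => /eqP; rewrite psumr_eq0 => [/allP h|i _]; last exact: sqr_ge0.
have mu0 : mu = 0.
  apply/rowP => i; rewrite [RHS]mxE; apply/eqP.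
  by have := h i (mem_index_enum _); rewrite /= sqrf_eq0.
rewrite -[v]coord_mxK UE mu0 (linear0 diag_mx) mulmx0 mul0mx.
by apply/eqP/matrixP => i j; rewrite !mxE.
Qed.

End coordinates.

(** * Optimality of the graphical lasso and two-sided bounds on [h] around it *)

Section glasso.
Context {R : realType} (p : nat) (G : model p) (n : nat) (lambda : R).
Context (S Om : 'M[R]_p).
Hypotheses (n0 : (0 < n)%N) (lambda0 : 0 < lambda).
Hypothesis glasso : is_glasso G n lambda S Om.

Let nR : 0 < n%:R :> R. Proof. by rewrite ltr0n. Qed.
Let posOm : posdefmx Om. Proof. by case: glasso => -[]. Qed.

Let pen (A : 'M[R]_p) : R := 2 * lambda / n%:R * \sum_(e in G) `|entry A e|.
(** The directional derivative at [Om] of every term of [hfun] except the off-diagonal penalty. *)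
Let lin (A : 'M[R]_p) : R :=
  \tr (S *m A) + lambda / n%:R * (\sum_i A i i) - \tr (invmx Om *m A).

(* The part of h (Om + U) - h Om left by the second-order remainder of
   log det. *)
Definition glasso_excess (U : 'M[R]_p) : R := lin U + pen (Om + U) - pen Om.

Let c0 : 0 <= 2 * lambda / n%:R :> R.
Proof. by rewrite divr_ge0 ?mulr_ge0 ?ltW. Qed.

Let pen_tri A B : pen (A + B) <= pen A + pen B.
Proof.
rewrite /pen -mulrDr -big_split /=; apply: ler_wpM2l => //.
by apply: ler_sum => e _; rewrite /entry mxE ler_normD.
Qed.

Let linZ t A : lin (t *: A) = t * lin A.
Proof.
rewrite /lin -!scalemxAr !mxtraceZ.
have -> : \sum_i (t *: A) i i = t * \sum_i A i i.
  by rewrite mulr_sumr; apply: eq_bigr => i _; rewrite mxE.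
ring.
Qed.

Let linN A : lin (- A) = - lin A.
Proof. by rewrite -scaleN1r linZ mulN1r. Qed.

Let penN A : pen (- A) = pen A.
Proof.
by rewrite /pen; congr (_ * _); apply: eq_bigr => e _; rewrite /entry mxE normrN.
Qed.

Lemma hfun_expansion (V : 'M[R]_p) (mu : 'rV[R]_p) : V \in unitmx ->
  Om = V *m V^T -> (forall i, -1 < mu 0 i) ->
  let U := V *m diag_mx mu *m V^T in
  hfun G n lambda S (Om + U) =
  hfun G n lambda S Om + \sum_i lnrem (mu 0 i) + glasso_excess U.
Proof.
move=> Vu OmE mu1 U; have d0 := posdef_det_gt0 posOm.
rewrite /hfun /glasso_excess /lin /pen -/U.
have -> : - ln (\det (Om + U)) = - ln (\det Om) - \tr (invmx Om *m U)
     + \sum_i lnrem (mu 0 i).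
  by rewrite /U {1 2 3}OmE ln_diag_det// -OmE.
rewrite mulmxDr mxtraceD.
have -> : \sum_i (Om + U) i i = \sum_i Om i i + \sum_i U i i.
  by rewrite -big_split /=; apply: eq_bigr => i _; rewrite mxE.
ring.
Qed.

(** The excess is a convex function of [U] vanishing at 0. *)
Let excess_cvx t U : 0 <= t <= 1 ->
  glasso_excess (t *: U) <= t * glasso_excess U.
Proof.
move=> /andP[t0 t1]; rewrite /glasso_excess linZ.
suff : pen (Om + t *: U) <= (1 - t) * pen Om + t * pen (Om + U) by lra.
rewrite /pen mulrCA (mulrCA t) -mulrDr; apply: ler_wpM2l => //.
rewrite !mulr_sumr -big_split /=; apply: ler_sum => e _; rewrite /entry !mxE.
set a := Om _ _; set b := U _ _.
have -> : a + t * b = (1 - t) * a + t * (a + b) by ring.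
have t1' : 0 <= 1 - t by rewrite subr_ge0.
by rewrite (le_trans (ler_normD _ _))// !normrM (ger0_norm t0) (ger0_norm t1').
Qed.

(** This replaces the subgradient conditions at the minimizer. If the excess were negative at [U], a
    step [t U] would change [h] by at most [t] times that negative number plus [t ^ 2 q], which is
    negative for small [t]. *)
Lemma glasso_excess_ge0 U : U^T = U -> (forall e, e \notin G -> entry U e = 0) ->
  0 <= glasso_excess U.
Proof.
move=> sU U0; rewrite leNgt; apply/negP => ex0.
have [V [mu [Vu OmE UE]]] := simul_diag posOm sU.
pose q := \sum_k mu 0 k ^+ 2.
have q0 : 0 <= q by apply: sumr_ge0 => k _; exact: sqr_ge0.
(* The first bound keeps every [|t mu k|] at most 1/2, so that [Om + t U] stays in the cone and
   [lnrem] is at most the square; the second makes [t q] smaller than minus the excess. *)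
pose t : R := Num.min (2 * (1 + Num.sqrt q))^-1 (- glasso_excess U / (2 * (q + 1))).
have sq0 : 0 <= Num.sqrt q by exact: sqrtr_ge0.
have t0 : 0 < t.
  by rewrite lt_min invr_gt0 divr_gt0 ?mulr_gt0 ?oppr_gt0//; lra.
have t1 : t <= (2 * (1 + Num.sqrt q))^-1 by rewrite ge_min lexx.
have t2 : t <= - glasso_excess U / (2 * (q + 1)) by rewrite ge_min lexx orbT.
have muq k : `|mu 0 k| <= Num.sqrt q.
  rewrite -sqrtr_sqr ler_sqrt// /q (bigD1 k)//= lerDl sumr_ge0// => l _.
  exact: sqr_ge0.
have ts : t * (2 * (1 + Num.sqrt q)) <= 1.
  by rewrite -ler_pdivlMr ?mul1r//; lra.
have tmu k : `|(t *: mu) 0 k| <= 2^-1.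
  rewrite mxE normrM (gtr0_norm t0).
  have := ler_wpM2l (ltW t0) (muq k); have := t0; lra.
have tmu1 k : -1 < (t *: mu) 0 k.
  have := tmu k; rewrite ler_norml; lra.
have tUE : t *: U = V *m diag_mx (t *: mu) *m V^T.
  by rewrite linearZ /= -scalemxAr -scalemxAl -UE.
have := hfun_expansion Vu OmE tmu1; rewrite /= -tUE => hE.
have cone : in_cone G (Om + t *: U).
  split.
    by rewrite tUE {1}OmE; apply/(diag_posdef _ Vu).
  move=> e eG; rewrite /entry !mxE -!/(entry _ _) U0// mulr0 addr0.
  by have [[_ ->]] := glasso.
have [_ /(_ _ cone)] := glasso; rewrite hE.
have lr : \sum_i lnrem ((t *: mu) 0 i) <= t ^+ 2 * q.
  rewrite mulr_sumr; apply: ler_sum => i _.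
  have ti := tmu i.
  apply: (le_trans (lnrem_le _)); first by lra.
  have <- : ((t *: mu) 0 i) ^+ 2 = t ^+ 2 * mu 0 i ^+ 2 by rewrite mxE exprMn.
  rewrite -[leRHS]mulr1; apply: ler_wpM2l; first exact: sqr_ge0.
  by rewrite invf_le1; lra.
have t01 : 0 <= t <= 1 by rewrite ltW//=; move: (mulr_ge0 (ltW t0) sq0) ts; lra.
have := excess_cvx U t01.
move=> h1 h2.
have : 0 <= t * (t * q + glasso_excess U).
  have -> : t * (t * q + glasso_excess U) = t ^+ 2 * q + t * glasso_excess U.
    by ring.
  by move: h1 h2 lr; lra.
rewrite pmulr_rge0// => h3.
have : t * (2 * (q + 1)) <= - glasso_excess U by rewrite -ler_pdivlMr//; lra.
have := t0; nra.
Qed.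

(** The linear part is odd, so nonnegativity of the excess at [- U] bounds [lin U] by [pen U]; the
    triangle inequality gives a second [pen U]. *)
Lemma glasso_excess_le U : U^T = U -> (forall e, e \notin G -> entry U e = 0) ->
  glasso_excess U <= 2 * (2 * lambda / n%:R * \sum_(e in G) `|entry U e|).
Proof.
move=> sU U0.
have h : 0 <= glasso_excess (- U).
  apply: glasso_excess_ge0; first by rewrite linearN /= sU.
  by move=> e eG; rewrite /entry mxE -/(entry _ _) U0// oppr0.
rewrite -/(pen U); move: h; rewrite /glasso_excess linN.
have := pen_tri Om U; have := pen_tri Om (- U); rewrite penN; lra.
Qed.

Context (v : 'cV[R]_#|vset G|).
Let U := coord_mx v.
Let q := qf (Hmx G Om) v.

(** The excess is dropped, and [|mu k| <= sqrt q <= c] controls the denominators. Having [c] free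
    lets one constant serve a whole shell. *)
Lemma hfun_lower (c : R) : Num.sqrt q <= c -> posdefmx (Om + U) ->
  n%:R / 4 * q / (1 + c) <=
  n%:R * hfun G n lambda S (Om + U) / 2 - n%:R * hfun G n lambda S Om / 2.
Proof.
move=> qc pOU.
have [V [mu [Vu OmE UE]]] := simul_diag posOm (tr_coord_mx v).
have qE : q = \sum_k mu 0 k ^+ 2.
  by rewrite /q qf_Hmx UE {1 2}OmE diag_tr2.
have muq k : `|mu 0 k| <= Num.sqrt q.
  rewrite -sqrtr_sqr ler_sqrt qE ?sumr_ge0// => [|l _]; last exact: sqr_ge0.
  by rewrite (bigD1 k)//= lerDl sumr_ge0// => l _; exact: sqr_ge0.
have mu1 : forall i, -1 < mu 0 i.
  by apply/(diag_posdef _ Vu); rewrite -OmE -UE.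
have c1 : 0 <= c by apply: le_trans qc; exact: sqrtr_ge0.
have ex0 : 0 <= glasso_excess U.
  by apply: glasso_excess_ge0; [exact: tr_coord_mx|exact: coord_mx_entry0].
have := hfun_expansion Vu OmE mu1; rewrite /= -UE -/U => ->.
have lr : q / (2 * (1 + c)) <= \sum_i lnrem (mu 0 i).
  rewrite qE mulr_suml; apply: ler_sum => i _.
  apply: le_trans (lnrem_ge (mu1 i)); apply: ler_wpM2l; first exact: sqr_ge0.
  rewrite lef_pV2 ?posrE ?mulr_gt0 ?ltr_pwDl//.
  by rewrite ler_pM2l// lerD2l (le_trans (muq i)).
have -> : n%:R / 4 * q / (1 + c) = n%:R / 2 * (q / (2 * (1 + c))).
  by field; rewrite gt_eqF//; lra.
move: (ler_wpM2l (ltW nR) lr) (mulr_ge0 (ltW nR) ex0); lra.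
Qed.

Lemma hfun_upper (C r : R) : (forall i, Om i i <= C) ->
  Num.sqrt q <= r -> r <= 2^-1 ->
  posdefmx (Om + U) /\
  n%:R * hfun G n lambda S (Om + U) / 2 - n%:R * hfun G n lambda S Om / 2 <=
  n%:R / 4 * q * (1 + 2 * r) + 2 * lambda * #|G|%:R * C * Num.sqrt q.
Proof.
move=> OC qr r2.
have [V [mu [Vu OmE UE]]] := simul_diag posOm (tr_coord_mx v).
have qE : q = \sum_k mu 0 k ^+ 2.
  by rewrite /q qf_Hmx UE {1 2}OmE diag_tr2.
have muq k : `|mu 0 k| <= Num.sqrt q.
  rewrite -sqrtr_sqr ler_sqrt qE ?sumr_ge0// => [|l _]; last exact: sqr_ge0.
  by rewrite (bigD1 k)//= lerDl sumr_ge0// => l _; exact: sqr_ge0.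
have mur k : `|mu 0 k| <= r by exact: le_trans (muq k) qr.
have mu1 i : -1 < mu 0 i.
  by have := mur i; rewrite ler_norml; lra.
split; first by rewrite /U UE {1}OmE; apply/(diag_posdef _ Vu).
have := hfun_expansion Vu OmE mu1; rewrite /= -UE -/U => ->.
have ex : glasso_excess U <=
    2 * (2 * lambda / n%:R * \sum_(e in G) `|entry U e|).
  by apply: glasso_excess_le; [exact: tr_coord_mx|exact: coord_mx_entry0].
have sU : \sum_(e in G) `|entry U e| <= #|G|%:R * C * Num.sqrt q.
  have -> : #|G|%:R * C * Num.sqrt q = \sum_(e in G) Num.sqrt q * C.
    by rewrite sumr_const -mulr_natl; ring.
  apply: ler_sum => e _; rewrite /entry /U UE.
  apply: (le_trans (diag_entry_le _ _ _ _)); rewrite -qE -OmE.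
  by apply: ler_wpM2l; [exact: sqrtr_ge0|have := OC (val e).1; have := OC (val e).2; lra].
have lr : \sum_i lnrem (mu 0 i) <= q / 2 * (1 + 2 * r).
  rewrite qE !mulr_suml; apply: ler_sum => i _.
  have mi := mur i; have mi0 := normr_ge0 (mu 0 i).
  apply: (le_trans (lnrem_le _)); first lra.
  rewrite -mulrA; apply: ler_wpM2l; first exact: sqr_ge0.
  rewrite invfM; apply: ler_wpM2l; first lra.
  (* [1 / (1 - |mu i|) <= 1 + 2 r], because [|mu i| <= r <= 1/2]. *)
  rewrite -div1r ler_pdivrMr; nra.
have e2 : n%:R * glasso_excess U / 2 <= 2 * lambda * #|G|%:R * C * Num.sqrt q.
  apply: (@le_trans _ _ (2 * lambda * \sum_(e in G) `|entry U e|)).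
    move: (ler_wpM2l (ltW nR) ex).
    have -> : n%:R * (2 * (2 * lambda / n%:R * \sum_(e in G) `|entry U e|)) =
      2 * (2 * lambda * \sum_(e in G) `|entry U e|) by field; rewrite gt_eqF.
    lra.
  rewrite -!mulrA; apply: ler_wpM2l => //; apply: ler_wpM2l; first exact: ltW.
  by rewrite !mulrA.
move: (ler_wpM2l (ltW nR) lr); lra.
Qed.

End glasso.

(** * Comparison of the posterior integral with Gaussian integrals *)

(** The integral of a nonnegative function is a supremum over simple functions below it, so
    pointwise comparison suffices. The posterior integrand is thus compared with Gaussians directly,
    measurability being checked for the Gaussians only. *)
Lemma ge0_subset_le_integral d (T : measurableType d) (R : realType)
    (mu : {measure set T -> \bar R}) (D1 D2 : set T) (f g : T -> \bar R) :
  (forall x, D1 x -> 0 <= f x)%E -> (forall x, D2 x -> 0 <= g x)%E ->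
  (forall x, (f \_ D1) x <= (g \_ D2) x)%E ->
  (\int[mu]_(x in D1) f x <= \int[mu]_(x in D2) g x)%E.
Proof.
move=> f0 g0 fg; rewrite !ge0_integralE//; apply: le_ereal_sup.
move=> _ [h /= hf <-]; exists h => //= x; exact: le_trans (hf x) (fg x).
Qed.

Section laplace_integral.
Context {R : realType} (m : nat) (H : 'M[R]_m) (c : 'cV[R]_m) (n : R).
Hypotheses (posH : posdefmx H) (n0 : 0 < n).

Let q (x : Rtuple R m) : R := qf H (col_of x - c).

Let q0 x : 0 <= q x.
Proof.
rewrite /q; have [->|v0] := eqVneq (col_of x - c) 0.
  by rewrite /qf mulmx0 mxE.
by apply: ltW; case: posH => _; exact.
Qed.

Let mq : measurable_fun [set: Rtuple R m] q.
Proof. exact: measurable_qf. Qed.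

(** The integral of [exp (- (n / 4) q)], written as in [laplace_approx]. *)
Definition gauss_mass : R := (4 * pi / n) `^ (m%:R / 2) * (\det H) `^ (- (1 / 2)).

Lemma gauss_mass_gt0 : 0 < gauss_mass.
Proof.
by rewrite mulr_gt0 ?powR_gt0 ?divr_gt0 ?mulr_gt0 ?pi_gt0// posdef_det_gt0.
Qed.

Let mg (K a : R) : measurable_fun [set: Rtuple R m]
  (fun x => (K * expR (- (a * (n / 4) * q x)))%:E).
Proof.
apply/measurable_EFinP; apply: measurable_funM => //.
apply: measurableT_comp => //; apply: measurableT_comp => //.
exact: measurable_funM.
Qed.

Lemma integral_gauss_scaled (K a : R) : 0 <= K -> 0 < a ->
  (\int[lebesgue_tuple R m]_x (K * expR (- (a * (n / 4) * q x)))%:E =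
   (K * (Num.sqrt a ^- m * gauss_mass))%:E)%E.
Proof.
move=> K0 a0; set t := a * (n / 4).
have t0 : 0 < t by rewrite mulr_gt0// divr_gt0.
under eq_integral do rewrite EFinM.
rewrite ge0_integralZl_EFin//; last first.
  by have := mg 1 a; under eq_fun do rewrite mul1r.
rewrite [RHS]EFinM; congr (_ * _)%E.
have tH : posdefmx (t *: H).
  case: posH => sH pH; split; first by rewrite linearZ /= sH.
  by move=> v v0; rewrite -scalemxAr -scalemxAl mxE mulr_gt0// pH.
have qt v : qf (t *: H) v = t * qf H v.
  by rewrite /qf -scalemxAr -scalemxAl mxE.
have -> : (\int[lebesgue_tuple R m]_x (expR (- (t * q x)))%:E =
    \int[lebesgue_tuple R m]_x (expR (- qf (t *: H) (col_of x - c)))%:E)%E.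
  by apply: eq_integral => x _; rewrite qt.
rewrite integral_gauss//; congr (_%:E).
have d0 := posdef_det_gt0 posH.
have p0 := pi_gt0 R.
rewrite detZ /gauss_mass powRN div1r powR12_sqrt ?ltW// -[m%:R / 2]mulrC.
rewrite powRrM powR12_sqrt; last by rewrite divr_ge0 ?mulr_ge0 ?ltW.
rewrite powR_mulrn ?sqrtr_ge0// -exprVn -!sqrtrV ?ltW// mulrA -exprMn.
rewrite -sqrtrM ?invr_ge0 ?ltW// -(ger0_norm (exprn_ge0 m (sqrtr_ge0 _))).
rewrite -sqrtr_sqr -sqrtrM ?sqr_ge0//; congr Num.sqrt.
rewrite exprAC sqr_sqrtr; last first.
  by rewrite mulr_ge0 ?invr_ge0 ?divr_ge0 ?mulr_ge0 ?ltW.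
rewrite invfM mulrA -exprVn -exprMn; congr (_ ^+ m * _).
by rewrite /t; field; rewrite !gt_eqF.
Qed.

Context (D : set (Rtuple R m)) (F : Rtuple R m -> R) (F0 : R).

Let E0 := expR (- F0).
Let I := (\int[lebesgue_tuple R m]_(x in D) (expR (- F x))%:E)%E.

Let E00 : 0 <= E0. Proof. exact: expR_ge0. Qed.

(** The Gaussian used on shell [k] has mass larger by [sqrt (6 k) ^ m], which this absorbs into
    [(8 ^ m) ^ k]. *)
Let six_le8 k : 6 * k.+1%:R <= 8 ^+ k.+1 :> R.
Proof.
elim: k => [|k IH]; first by rewrite expr1; lra.
rewrite [in leRHS]exprS -natr1; have : 1 <= k.+1%:R :> R by rewrite ler1n.
lra.
Qed.

Let sqrt_le (y : R) : 1 <= y -> Num.sqrt y <= y.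
Proof.
move=> y1; have y0 : 0 <= y by apply: le_trans y1.
rewrite -[leRHS]ger0_norm// -sqrtr_sqr ler_sqrt ?sqr_ge0//.
by rewrite expr2 ler_peMr.
Qed.

Let geometric_le (A z : R) N : 0 <= A -> 0 <= z -> z <= 2^-1 ->
  \sum_(0 <= k < N) (if k is k'.+1 then z ^+ k else A) <= A + 2 * z.
Proof.
move=> A0 z0 z2; case: N => [|N].
  by rewrite big_geq// addr_ge0// mulr_ge0.
(* The subtracted term strengthens the bound so that induction on [N] goes through. *)
apply: (@le_trans _ _ (A + 2 * z - 2 * z ^+ N.+1)); last first.
  by rewrite gerBl mulr_ge0 ?exprn_ge0.
elim: N => [|N IH]; first by rewrite big_nat1 expr1; lra.
rewrite big_nat_recr//=; have zN : 0 <= z ^+ N.+1 by rewrite exprn_ge0.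
have : z ^+ N.+2 <= 2^-1 * z ^+ N.+1 by rewrite exprS ler_wpM2r.
move: IH zN; lra.
Qed.

(* On the shell k r <= sqrt q < (k + 1) r the remainder is at least
   (n / 4) q / (1 + (k + 1) r); for k >= 1 half of it is spent on making the
   masses of the shells summable. *)
Lemma laplace_integral_le (r : R) : 0 < r -> r <= 1 ->
  (forall x, D x -> forall s, Num.sqrt (q x) <= s ->
    n / 4 * q x / (1 + s) <= F x - F0) ->
  8 ^+ m * expR (- (n * r ^+ 2 / 24)) <= 2^-1 ->
  (I <= (E0 * gauss_mass * (Num.sqrt (1 + r) ^+ m +
     2 * (8 ^+ m * expR (- (n * r ^+ 2 / 24)))))%:E)%E.
Proof.
move=> r0 r1 HF; set z := 8 ^+ m * _ => z2.
have z0 : 0 <= z by rewrite mulr_ge0 ?expR_ge0.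
(* For [k >= 1] and [r <= 1], [1 + (k + 1) r <= 3 k], so the remainder is at least
   [(n / 4) q / (3 k)]. One half is the Gaussian of rate [1 / (6 k)]; the other is at least
   [k n r ^ 2 / 24], since [q >= (k r) ^ 2], and gives [K k]. *)
pose K k : R := E0 * (if k is k'.+1 then expR (- (n * r ^+ 2 / 24)) ^+ k else 1).
pose a k : R := if k is k'.+1 then (6 * k%:R)^-1 else (1 + r)^-1.
have K0 k : 0 <= K k by rewrite /K; case: k => [|k]; rewrite mulr_ge0 ?exprn_ge0 ?expR_ge0.
have a0 k : 0 < a k by rewrite /a; case: k => [|k]; rewrite invr_gt0 ?mulr_gt0 ?ltr0n//; lra.
pose g k (x : Rtuple R m) : \bar R := (K k * expR (- (a k * (n / 4) * q x)))%:E.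
have g0 k x : (0 <= g k x)%E by rewrite lee_fin mulr_ge0 ?expR_ge0.
have fg x : D x -> ((expR (- F x))%:E <= \sum_(0 <= k <oo) g k x)%E.
  move=> Dx; pose k := Num.truncn (Num.sqrt (q x) / r).
  have sr0 : 0 <= Num.sqrt (q x) / r by rewrite divr_ge0 ?sqrtr_ge0 ?ltW.
  have /andP[k1 k2] := truncn_itv sr0.
  rewrite ler_pdivlMr// in k1; rewrite ltr_pdivrMr// in k2.
  have := HF _ Dx _ (ltW k2) => {}HF.
  apply: (@le_trans _ _ (g k x)); last first.
    apply: le_trans (nneseries_lim_ge k.+1 _) => //.
    by rewrite big_nat_recr//= leeDr// sume_ge0.
  rewrite lee_fin -/k in k1 HF *.
  case: k k1 HF {k2} => [_|k] /=.
    rewrite mul1r => HF; rewrite /K /a mulr1 /E0 -expRD ler_expR.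
    by move: HF; rewrite (mulrC (1 + r)^-1) mulrAC; lra.
  move=> k1 HF; rewrite /K /a /E0 -expRM_natl -!expRD ler_expR.
  have kp : 1 <= k.+1%:R :> R by rewrite ler1n.
  have sq : (k.+1%:R * r) ^+ 2 <= q x.
    rewrite -[leRHS]sqr_sqrtr// ler_pXn2r// ?nnegrE ?sqrtr_ge0//.
    by rewrite mulr_ge0// ltW.
  have le3 : 1 + k.+2%:R * r <= 3 * k.+1%:R :> R.
    rewrite -[k.+2%:R]natr1; nra.
  have d0 : 0 < 1 + k.+2%:R * r by rewrite ltr_pwDl// mulr_ge0// ltW.
  have h1 : n / 4 * q x / (3 * k.+1%:R) <= n / 4 * q x / (1 + k.+2%:R * r).
    apply: ler_wpM2l; first by rewrite mulr_ge0// divr_ge0 ?ltW.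
    by rewrite lef_pV2 ?posrE// mulr_gt0//; lra.
  have h2 : n / 4 * (k.+1%:R * r) ^+ 2 / (6 * k.+1%:R) <=
      n / 4 * q x / (6 * k.+1%:R).
    apply: ler_wpM2r; first by rewrite invr_ge0 mulr_ge0.
    by apply: ler_wpM2l => //; rewrite divr_ge0 ?ltW.
  have e1 : n / 4 * q x / (3 * k.+1%:R) = 2 * (n / 4 * q x / (6 * k.+1%:R)).
    by field; rewrite gt_eqF//; lra.
  have e2 : n / 4 * (k.+1%:R * r) ^+ 2 / (6 * k.+1%:R) =
      k.+1%:R * (n * r ^+ 2 / 24).
    by field; rewrite gt_eqF//; lra.
  have e3 : (6 * k.+1%:R)^-1 * (n / 4) * q x = n / 4 * q x / (6 * k.+1%:R).
    by ring.
  rewrite e3 mulrN; move: (le_trans h1 HF) h2; rewrite e1 e2.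
  by move: (n / 4 * q x / (6 * _)) (_ * (_ / 24)) => u w; lra.
apply: (@le_trans _ _ (\int[lebesgue_tuple R m]_x \sum_(0 <= k <oo) g k x)%E).
  apply: ge0_subset_le_integral => [x _|x _|x].
  - by rewrite lee_fin expR_ge0.
  - by apply: nneseries_ge0 => k _ _; exact: g0.
  - rewrite patch_setT /patch; case: ifPn => [|_]; first by rewrite inE; exact: fg.
    by apply: nneseries_ge0 => k _ _; exact: g0.
rewrite integral_nneseries//; last by move=> k; exact: mg.
apply: lime_le; first by apply: is_cvg_nneseries => k _ _; exact: integral_ge0.
apply: nearW => N.
have gm := gauss_mass_gt0.
have bnd k : (\int[lebesgue_tuple R m]_x g k x <=
    (E0 * gauss_mass * (if k is k'.+1 then z ^+ k else Num.sqrt (1 + r) ^+ m))%:E)%E.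
  rewrite integral_gauss_scaled// lee_fin /K /a; case: k => [|k].
    by rewrite mulr1 sqrtrV ?exprVn ?invrK; [rewrite mulrCA mulrC mulrA lexx|lra].
  rewrite sqrtrV ?mulr_ge0// exprVn invrK -(mulrA E0) -(mulrA E0 gauss_mass).
  apply: ler_wpM2l => //; rewrite mulrA [leLHS]mulrC.
  apply: ler_wpM2l; first exact: ltW.
  rewrite /z exprMn mulrC; apply: ler_wpM2r; first by rewrite exprn_ge0// expR_ge0.
  rewrite exprAC; apply: lerXn2r; rewrite ?nnegrE ?sqrtr_ge0 ?exprn_ge0//.
  apply: le_trans (six_le8 k); apply: sqrt_le.
  by have : 1 <= k.+1%:R :> R; [rewrite ler1n|lra].
apply: (le_trans (lee_sum _ (fun k _ => bnd k))).
rewrite sumEFin lee_fin -mulr_sumr; apply: ler_wpM2l.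
  by rewrite mulr_ge0// ltW.
exact: geometric_le.
Qed.

(* The excess mass outside the ball sqrt q <= r of the minorant is absorbed by
   the second Gaussian. *)
Lemma laplace_integral_ge (r b dl : R) : 0 < r -> 0 < dl -> 0 <= b ->
  (forall x, Num.sqrt (q x) <= r -> D x /\
    F x - F0 <= n / 4 * q x * (1 + 2 * r) + b * Num.sqrt (q x)) ->
  ((E0 * gauss_mass *
     (expR (- dl) * Num.sqrt (1 + 2 * r + b ^+ 2 / (n * dl)) ^- m -
      expR (- (n * r ^+ 2 / 8)) * Num.sqrt 2 ^+ m))%:E <= I)%E.
Proof.
move=> r0 dl0 b0 HF; set ta := 1 + _ + _.
have bb : 0 <= b ^+ 2 / (n * dl) by rewrite divr_ge0 ?sqr_ge0 ?mulr_ge0 ?ltW.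
have ta1 : 1 <= ta by rewrite /ta; lra.
(* [g1] is below the integrand on the ball, and [g2] dominates [g1] outside it. The positive part of
   [g1 - g2] is therefore a minorant everywhere, and its integral is at least the difference of two
   Gaussian masses. *)
pose g1 x := E0 * expR (- dl) * expR (- (ta * (n / 4) * q x)).
pose g2 x := E0 * expR (- (n * r ^+ 2 / 8)) * expR (- (2^-1 * (n / 4) * q x)).
have mg1 : measurable_fun [set: Rtuple R m] (EFin \o g1) by exact: mg.
have mg2 : measurable_fun [set: Rtuple R m] (EFin \o g2) by exact: mg.
pose g x := Num.max 0 (g1 x - g2 x).
have mgg : measurable_fun [set: Rtuple R m] (EFin \o g).
  apply/measurable_EFinP; apply: measurable_maxr => //.
  by apply: measurable_funB; apply/measurable_EFinP.
have g0 x : 0 <= g x by rewrite le_max lexx.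
have g20 x : 0 <= g2 x by rewrite !mulr_ge0 ?expR_ge0.
have gI : (\int[lebesgue_tuple R m]_x (g x)%:E <= I)%E.
  apply: ge0_subset_le_integral => [x _|x _|x].
  - by rewrite lee_fin.
  - by rewrite lee_fin expR_ge0.
  rewrite patch_setT /patch.
  have [qr|qr] := leP (Num.sqrt (q x)) r.
    have [Dx Fx] := HF _ qr; rewrite mem_set// lee_fin /g ge_max expR_ge0/=.
    rewrite lerBlDr ler_wpDr//.
    rewrite /g1 /E0 -!expRD ler_expR.
    set s := Num.sqrt (q x) in Fx *.
    have sq : q x = s ^+ 2 by rewrite sqr_sqrtr.
    (* The linear penalty term is traded, by completing a square, for the constant [dl] and a small
       multiple of [q]; this explains the last term of [ta]. *)
    have : b * s <= dl + b ^+ 2 / (n * dl) * (n / 4) * q x.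
      rewrite sq -subr_ge0.
      have -> : dl + b ^+ 2 / (n * dl) * (n / 4) * s ^+ 2 - b * s =
         (2 * dl - b * s) ^+ 2 / (4 * dl) by field; rewrite !gt_eqF.
      by rewrite divr_ge0 ?sqr_ge0 ?mulr_ge0 ?ltW.
    by rewrite /ta; lra.
  have -> : g x = 0.
    rewrite /g; apply/max_idPl; rewrite subr_le0 /g1 /g2 -!mulrA.
    apply: ler_wpM2l => //; rewrite -!expRD ler_expR.
    have rq : r ^+ 2 <= q x.
      rewrite -[leRHS]sqr_sqrtr// ler_pXn2r// ?nnegrE ?sqrtr_ge0 ?ltW//.
    have h1 := ler_wpM2l (ltW n0) rq.
    have h2 : n * q x <= ta * (n * q x).
      by rewrite ler_peMl// mulr_ge0// ltW.
    by lra.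
  by case: ifPn => _; rewrite lee_fin ?expR_ge0.
apply: le_trans gI.
have E1 : (\int[lebesgue_tuple R m]_x (g1 x)%:E =
    (E0 * expR (- dl) * (Num.sqrt ta ^- m * gauss_mass))%:E)%E.
  by rewrite integral_gauss_scaled ?mulr_ge0 ?expR_ge0//; lra.
have E2 : (\int[lebesgue_tuple R m]_x (g2 x)%:E =
    (E0 * expR (- (n * r ^+ 2 / 8)) * (Num.sqrt 2^-1 ^- m * gauss_mass))%:E)%E.
  by rewrite integral_gauss_scaled ?mulr_ge0 ?expR_ge0//; lra.
have : (\int[lebesgue_tuple R m]_x (g1 x)%:E <=
    \int[lebesgue_tuple R m]_x ((g x)%:E + (g2 x)%:E))%E.
  apply: ge0_subset_le_integral => [x _|x _|x].
  - by rewrite lee_fin !mulr_ge0 ?expR_ge0.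
  - by rewrite adde_ge0 ?lee_fin.
  - rewrite !patch_setT -EFinD lee_fin -lerBlDr /g le_max lexx orbT//.
rewrite ge0_integralD//; try by [move=> x _; rewrite lee_fin].
rewrite E1 E2 -leeBlDr// -EFinB; apply: le_trans.
rewrite lee_fin sqrtrV// exprVn invrK.
by rewrite le_eqVlt; apply/orP; left; apply/eqP; ring.
Qed.

End laplace_integral.

(** * Convergence of the Laplace ratio *)

Section laplace_ratio.
Context {R : realType}.

(** With coordinates centred at those of [Om], both integral bounds carry the factor
    [expR (- F0) * gm], which is the Laplace approximation itself. The upper bound also makes the
    integral finite, so [fine] preserves it. *)
Lemma laplace_ratio_bounds p (G : model p) n (lambda : R) (S Om : 'M[R]_p)
    (C r dl : R) :
  (0 < n)%N -> 0 < lambda -> is_glasso G n lambda S Om ->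
  0 <= C -> (forall i, Om i i <= C) -> 0 < r -> r <= 2^-1 -> 0 < dl ->
  let m := #|vset G| in
  8 ^+ m * expR (- (n%:R * r ^+ 2 / 24)) <= 2^-1 ->
  expR (- dl) * Num.sqrt
      (1 + 2 * r + (2 * lambda * #|G|%:R * C) ^+ 2 / (n%:R * dl)) ^- m -
    expR (- (n%:R * r ^+ 2 / 8)) * Num.sqrt 2 ^+ m
  <= laplace_ratio G n lambda S Om <=
  Num.sqrt (1 + r) ^+ m + 2 * (8 ^+ m * expR (- (n%:R * r ^+ 2 / 24))).
Proof.
move=> n0 l0 glasso C0 OC r0 r2 dl0 m z2.
have [[pO Om0] _] := glasso; have [sO _] := pO.
have pH := posdef_Hmx G pO.
have nR : 0 < n%:R :> R by rewrite ltr0n.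
pose c := mx_coords G Om.
pose D := [set x : Rtuple R m | posdefmx (mx_of_coords x)].
pose F (x : Rtuple R m) := n%:R * hfun G n lambda S (mx_of_coords x) / 2.
pose F0 := n%:R * hfun G n lambda S Om / 2.
have mxE' (x : Rtuple R m) : mx_of_coords x = Om + coord_mx (col_of x - c).
  by rewrite mx_of_coordsE coord_mxB /c mx_coordsK// addrC subrK.
pose gm := gauss_mass (Hmx G Om) n%:R.
have gm0 : 0 < gm by exact: gauss_mass_gt0.
have up : (post_integral G n lambda S <=
    (expR (- F0) * gm * (Num.sqrt (1 + r) ^+ m +
       2 * (8 ^+ m * expR (- (n%:R * r ^+ 2 / 24)))))%:E)%E.
  apply: (@laplace_integral_le R m (Hmx G Om) c n%:R pH nR D F F0) => //; first lra.
  move=> x; rewrite /D /F /F0 /= mxE' => Dx s qs.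
  exact: (hfun_lower n0 l0 glasso).
have lo : ((expR (- F0) * gm * (expR (- dl) * Num.sqrt
      (1 + 2 * r + (2 * lambda * #|G|%:R * C) ^+ 2 / (n%:R * dl)) ^- m -
    expR (- (n%:R * r ^+ 2 / 8)) * Num.sqrt 2 ^+ m))%:E <=
    post_integral G n lambda S)%E.
  apply: (@laplace_integral_ge R m (Hmx G Om) c n%:R pH nR D F F0) => //.
    by rewrite !mulr_ge0// ltW.
  move=> x qs; rewrite /D /F /F0 /= mxE'.
  exact: (hfun_upper n0 l0 glasso).
have post0 : (0 <= post_integral G n lambda S)%E.
  by apply: integral_ge0 => x _; rewrite lee_fin expR_ge0.
have postf : post_integral G n lambda S \is a fin_num.
  by rewrite ge0_fin_numE// (le_lt_trans up)// ltry.
have lapE : laplace_approx G n lambda S Om = expR (- F0) * gm.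
  by rewrite /laplace_approx /gm /gauss_mass mulrA.
have lap0 : 0 < expR (- F0) * gm by rewrite mulr_gt0// expR_gt0.
rewrite -(fineK postf) !lee_fin in up lo.
by rewrite /laplace_ratio lapE ler_pdivlMr// ler_pdivrMr// ![_ * (_ * gm)]mulrC lo up.
Qed.

Lemma sqrt_expR_le (x : R) : Num.sqrt (1 + x) <= expR (x / 2).
Proof.
have e0 : 0 <= expR (x / 2) by exact: expR_ge0.
rewrite -[leRHS]ger0_norm// -sqrtr_sqr ler_wsqrtr// -expRM_natl.
by rewrite mulrC divfK// expR_ge1Dx.
Qed.

Lemma expR_le_affine (x : R) : 0 <= x -> x <= 2^-1 -> expR x <= 1 + 2 * x.
Proof.
move=> x0 x2; have h : 1 - x <= expR (- x) by have := expR_ge1Dx (- x); lra.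
have d0 : 0 < 1 + 2 * x by lra.
rewrite -[expR x]invrK -expRN -[leRHS]invrK lef_pV2 ?posrE ?invr_gt0 ?expR_gt0//.
apply: le_trans h; rewrite -div1r ler_pdivrMr//; nra.
Qed.

Lemma expR3_ge8 : 8 <= expR 3 :> R.
Proof.
have -> : 3 = 3%:R * 1 :> R by rewrite mulr1.
rewrite expRM_natl; have -> : 8 = 2 ^+ 3 :> R by rewrite -natrX.
apply: lerXn2r; rewrite ?nnegrE ?expR_ge0//.
by have := expR_ge1Dx (1 : R); lra.
Qed.

(** [kappa] depends on [lambda], [C] and [eps] only: the estimate is uniform in the dimension, the
    graph and the data. *)
Lemma laplace_ratio_cvg1 (lambda C eps : R) : 0 < lambda -> 0 <= C -> 0 < eps ->
  exists2 kappa : R, 0 < kappa &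
  forall p (G : model p) n (S Om : 'M[R]_p),
    (0 < p)%N -> (0 < n)%N -> is_glasso G n lambda S Om ->
    (forall i, Om i i <= C) ->
    (p + #|G|)%:R ^+ 3 <= kappa * n%:R ->
    `|laplace_ratio G n lambda S Om - 1| <= eps.
Proof.
move=> l0 C0 eps0.
(* The upper bound will be [1 + 2 ze + 2 ze] and the lower one [1 - 3 ze - ze], hence the quarter of
   [eps]. *)
pose ze : R := Num.min 2^-1 (eps / 4).
have ze0 : 0 < ze by rewrite lt_min invr_gt0 ltr0n/= divr_gt0.
have ze2 : ze <= 2^-1 by rewrite ge_min lexx.
have zee : 4 * ze <= eps.
  have : ze <= eps / 4 by rewrite ge_min lexx orbT.
  lra.
pose L := (lambda * C) ^+ 2; have L0 : 0 <= L by exact: sqr_ge0.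
(* The factor [100 (1 + L)] covers both later demands, [4 L] for the penalty and [72 ze + 24] for
   the tails. *)
pose kappa := ze ^+ 3 / (100 * (1 + L)).
have L1 : 0 < 100 * (1 + L) by rewrite mulr_gt0//; lra.
have kappa0 : 0 < kappa by rewrite divr_gt0// exprn_gt0.
exists kappa => // p G n S Om p0 n0 glasso OC.
move=> pGn; have nR : 0 < n%:R :> R by rewrite ltr0n.
pose m := #|vset G|.
have [M [M1 mM GM Mn]] : exists M : R,
    [/\ 1 <= M, m%:R <= M, #|G|%:R <= M & M ^+ 3 <= kappa * n%:R].
  exists (p + #|G|)%:R; split => //; last by rewrite ler_nat leq_addl.
    by rewrite ler1n addn_gt0 p0.
  rewrite ler_nat /m /vset (leq_trans (leq_card_setU _ _))// leq_add//.
    rewrite (_ : [set ij | _]%SET = [set (i, i) | i : 'I_p]%SET).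
      by rewrite (leq_trans (leq_imset_card _ _))// card_ord.
    apply/setP => -[i j]; rewrite inE /=; apply/eqP/imsetP => [->|[k _ [-> ->]]//].
    by exists j.
  exact: leq_imset_card.
have M0 : 0 < M by lra.
have m0 : 0 <= m%:R :> R by [].
pose r := ze / M.
have r0 : 0 < r by rewrite divr_gt0.
have rM : r * M = ze by rewrite /r divfK// gt_eqF.
have r2 : r <= 2^-1.
  by apply: le_trans ze2; rewrite -rM ler_peMr// ltW.
have mr : m%:R * r <= ze by rewrite -rM mulrC ler_wpM2l// ltW.
have MnR : M ^+ 3 * (100 * (1 + L)) <= ze ^+ 3 * n%:R.
  rewrite -ler_pdivlMr//; move: Mn; rewrite /kappa mulrAC; exact.
have eze := expR_le_affine (ltW ze0) ze2.
have up' : Num.sqrt (1 + r) ^+ m <= 1 + 2 * ze.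
  apply: le_trans eze.
  apply: (@le_trans _ _ (expR (r / 2) ^+ m)).
    by apply: lerXn2r; rewrite ?nnegrE ?sqrtr_ge0 ?expR_ge0 ?sqrt_expR_le.
  by rewrite -expRM_natl ler_expR; clear -mr ze0; lra.
pose b := 2 * lambda * #|G|%:R * C.
pose x := 2 * r + b ^+ 2 / (n%:R * ze).
have bb : m%:R * (b ^+ 2 / (n%:R * ze)) <= ze.
  have b2 : b ^+ 2 <= 4 * L * M ^+ 2.
    have -> : b ^+ 2 = 4 * L * #|G|%:R ^+ 2 by rewrite /b /L; ring.
    apply: ler_wpM2l; first by rewrite mulr_ge0.
    by apply: lerXn2r; rewrite ?nnegrE ?(ltW M0).
  rewrite mulrA ler_pdivrMr ?mulr_gt0//.
  apply: (@le_trans _ _ (M * (4 * L * M ^+ 2))).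
    by apply: ler_pM => //; exact: sqr_ge0.
  have h : M * (4 * L * M ^+ 2) <= M ^+ 3 * (100 * (1 + L)).
    have -> : M * (4 * L * M ^+ 2) = M ^+ 3 * (4 * L) by ring.
    by apply: ler_wpM2l; [rewrite exprn_ge0// ltW|clear -L0; lra].
  apply: (le_trans h); apply: (le_trans MnR).
  have -> : ze * (n%:R * ze) = ze ^+ 2 * n%:R by ring.
  apply: ler_wpM2r; first exact: ltW.
  by rewrite exprS ler_piMl ?sqr_ge0//; clear -ze2; lra.
have lo' : 1 - 3 * ze <=
    expR (- ze) * Num.sqrt (1 + 2 * r + b ^+ 2 / (n%:R * ze)) ^- m.
  (* One [ze] pays for [dl = ze] and two for the determinant factor, whose logarithm is at most
     [m x / 2 <= ze + ze / 2]. *)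
  apply: (@le_trans _ _ (expR (- (3 * ze)))).
    by have := expR_ge1Dx (- (3 * ze)); clear; lra.
  have -> : - (3 * ze) = - ze + - (2 * ze) by ring.
  rewrite expRD; apply: ler_wpM2l; first exact: expR_ge0.
  rewrite expRN lef_pV2 ?posrE ?expR_gt0//; last first.
    rewrite exprn_gt0// sqrtr_gt0; have : 0 <= b ^+ 2 / (n%:R * ze).
      by rewrite divr_ge0 ?sqr_ge0 ?mulr_ge0 ?ltW.
    by clear -r0; lra.
  rewrite -addrA -/x; apply: (@le_trans _ _ (expR (x / 2) ^+ m)).
    by apply: lerXn2r; rewrite ?nnegrE ?sqrtr_ge0 ?expR_ge0 ?sqrt_expR_le.
  by rewrite -expRM_natl ler_expR /x; clear -mr bb ze0; lra.
have tail : expR (- (n%:R * r ^+ 2 / 8)) * Num.sqrt 2 ^+ m <=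
    8 ^+ m * expR (- (n%:R * r ^+ 2 / 24)).
  rewrite mulrC; apply: ler_pM; rewrite ?expR_ge0//.
  - apply: lerXn2r; rewrite ?nnegrE ?sqrtr_ge0//.
    rewrite -[leRHS]ger0_norm// -sqrtr_sqr ler_wsqrtr//; clear; lra.
  - rewrite ler_expR lerN2.
    have : 0 <= n%:R * r ^+ 2 by rewrite mulr_ge0 ?sqr_ge0.
    by clear; lra.
(* The part [3 M] beats [8 ^ m <= exp (3 M)]; the part [M / ze] leaves [exp (- M / ze)], which is at
   most [ze] because [M >= 1]. *)
have nr : (3 + ze^-1) * M <= n%:R * r ^+ 2 / 24.
  have -> : n%:R * r ^+ 2 / 24 = (ze ^+ 3 * n%:R) / (24 * ze * M ^+ 2).
    by rewrite /r; field; rewrite !gt_eqF.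
  rewrite ler_pdivlMr ?mulr_gt0 ?exprn_gt0//.
  apply: le_trans MnR.
  have -> : (3 + ze^-1) * M * (24 * ze * M ^+ 2) = M ^+ 3 * (72 * ze + 24).
    by field; rewrite gt_eqF.
  by apply: ler_wpM2l; [rewrite exprn_ge0// ltW|clear -ze2 L0; lra].
have small : 8 ^+ m * expR (- (n%:R * r ^+ 2 / 24)) <= ze.
  apply: (@le_trans _ _ (expR (3 * M) * expR (- ((3 + ze^-1) * M)))).
    apply: ler_pM; rewrite ?exprn_ge0 ?expR_ge0//; last by rewrite ler_expR lerN2.
    apply: (@le_trans _ _ (expR 3 ^+ m)).
      by apply: lerXn2r; rewrite ?nnegrE ?expR_ge0 ?expR3_ge8.
    by rewrite -expRM_natl ler_expR mulrC ler_wpM2l.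
  rewrite -expRD; have -> : 3 * M - (3 + ze^-1) * M = - (ze^-1 * M) by ring.
  rewrite expRN -[leRHS]invrK lef_pV2 ?posrE ?invr_gt0 ?expR_gt0//.
  apply: (@le_trans _ _ (ze^-1 * M)).
    by rewrite ler_peMr// invr_ge0 ltW.
  by have := expR_ge1Dx (ze^-1 * M); clear; lra.
have z2 : 8 ^+ m * expR (- (n%:R * r ^+ 2 / 24)) <= 2^-1 by apply: le_trans ze2.
have := laplace_ratio_bounds n0 l0 glasso C0 OC r0 r2 ze0 z2.
rewrite -/m; set LR := laplace_ratio _ _ _ _ _ => /andP[].
rewrite -/b; move: up' lo' (le_trans tail small) (small).
move: (8 ^+ m * _) (Num.sqrt (1 + r) ^+ m) (_ * Num.sqrt _ ^- m)
  (_ * Num.sqrt 2 ^+ m) LR => x1 x2 x3 x4 x5 h1 h2 h3 h4 h5 h6.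
clear -zee ze0 h1 h2 h3 h4 h5 h6.
by rewrite ler_norml; apply/andP; split; lra.
Qed.

(** Squaring the rate gives [(p + s) ^ 5 ln p / n], which tends to 0; as [ln p >= 1/2] for [p >= 2],
    it controls [(p + s) ^ 3 / n]. *)
Lemma sum_cube_le (p : nat -> nat) (s : nat -> nat) (kappa : R) :
  (forall n, (0 < p n)%N) -> (forall n, p n = 1%N -> s n = 0%N) -> 0 < kappa ->
  ((p n + s n)%:R ^+ 2 * epsn R (p n) (s n) n @[n --> \oo] --> (0 : R)) ->
  \forall n \near \oo, (p n + s n)%:R ^+ 3 <= kappa * n%:R.
Proof.
move=> p0 p1 k0 /cvgr0_norm_le/(_ (Num.sqrt (kappa / 2))).
rewrite sqrtr_gt0 divr_gt0// => /(_ erefl) H.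
near=> n.
have nR : 0 < n%:R :> R by rewrite ltr0n; near: n; exists 1%N.
have M1 : 1 <= (p n + s n)%:R :> R by rewrite ler1n addn_gt0 p0.
(* For [p = 1] the logarithm vanishes and the rate carries no information, but then [p + s = 1] and
   [n >= 1 / kappa] is enough. *)
have [pn1|pn1] := eqVneq (p n) 1%N.
  rewrite pn1 p1// addn0 expr1n -ler_pdivrMl// mulr1.
  near: n; exact: nbhs_infty_ger.
have : `|(p n + s n)%:R ^+ 2 * epsn R (p n) (s n) n| <= Num.sqrt (kappa / 2).
  by near: n.
set M : R := (p n + s n)%:R in M1 *.
have lnp : 2^-1 <= ln (p n)%:R :> R.
  have p2 : (2 <= p n)%N by rewrite ltn_neqAle eq_sym pn1 p0.
  apply: (@le_trans _ _ (ln 2)); last first.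
    by rewrite ler_ln ?posrE ?ltr0n// ler_nat.
  have e : 2^-1 <= expR (- 2^-1) :> R.
    by have := expR_ge1Dx (- 2^-1 : R); lra.
  have : ln (2^-1 : R) <= ln (expR (- 2^-1)).
    by rewrite ler_ln ?posrE ?expR_gt0// invr_gt0.
  by rewrite expRK lnV ?posrE//; lra.
have M0 : 0 <= M by apply: le_trans M1.
rewrite ger0_norm; last first.
  by rewrite mulr_ge0 ?exprn_ge0// /epsn !mulr_ge0 ?invr_ge0 ?sqrtr_ge0.
move=> h.
have : (M ^+ 2 * epsn R (p n) (s n) n) ^+ 2 <= kappa / 2.
  rewrite -[leRHS]sqr_sqrtr; last by rewrite divr_ge0// ltW.
  apply: lerXn2r; rewrite ?nnegrE ?sqrtr_ge0//.
  by rewrite mulr_ge0 ?exprn_ge0// /epsn !mulr_ge0 ?invr_ge0 ?sqrtr_ge0.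
have -> : (M ^+ 2 * epsn R (p n) (s n) n) ^+ 2 = M ^+ 5 * ln (p n)%:R / n%:R.
  rewrite /epsn -/M !exprMn exprVn !sqr_sqrtr//; last by lra.
  by field; rewrite gt_eqF.
rewrite ler_pdivrMr// => h5.
have M3 : 0 <= M ^+ 3 by rewrite exprn_ge0.
have M35 : M ^+ 3 <= M ^+ 5 by apply: ler_weXn2l.
have : M ^+ 5 * 2^-1 <= M ^+ 5 * ln (p n)%:R.
  by apply: ler_wpM2l => //; rewrite exprn_ge0.
by move: h5 M35; lra.
Unshelve. all: by end_near. Qed.

Lemma entry_le_frobenius p (A : 'M[R]_p) i j : `|A i j| <= frobenius_norm A.
Proof.
rewrite /frobenius_norm -sqrtr_sqr ler_wsqrtr// (bigD1 i)//= (bigD1 j)//=.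
rewrite -addrA lerDl addr_ge0 ?sumr_ge0// => k _; first exact: sqr_ge0.
by apply: sumr_ge0 => l _; exact: sqr_ge0.
Qed.

Lemma model1_card (G : model 1) : #|G| = 0%N.
Proof.
apply/eqP; rewrite cards_eq0; apply/eqP/setP => -[[i j] /= ij].
by exfalso; move: ij; rewrite !ord1.
Qed.

End laplace_ratio.

(** For large [n], the ratio can be further than [dev] from 1 only where the Frobenius distance
    exceeds 1, so the outer probability is squeezed by one that tends to 0. *)
Theorem theorem4p4 (R : realType) (eps0 lambda : R) (p s : nat -> nat)
    (d : nat -> measure_display) (T : forall n, measurableType (d n))
    (P : forall n, probability (T n) R)
    (Om0 : forall n, 'M[R]_(p n))
    (X : forall n, 'I_n -> {RV (P n) >-> Rtuple R (p n)})
    (G : forall n, model (p n))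
    (Omstar : forall n, T n -> 'M[R]_(p n)) :
  0 < eps0 -> 0 < lambda ->
  (forall n, (0 < p n)%N) ->
  (forall n, uclass eps0 (s n) (Om0 n)) ->
  (forall n i, has_mvnormal (invmx (Om0 n)) (X n i)) ->
  (forall n, independent (X n)) ->
  (forall n, #|G n| = s n) ->
  (forall n, (0 < n)%N -> forall w, 
    is_glasso (G n) n lambda (sample_cov (fun i => X n i w)) (Omstar n w)) ->
  bounded_in_prob P (fun n w => frobenius_norm (Omstar n w - Om0 n))
        (fun n => epsn R (p n) (s n) n) ->
  cvg_in_prob P (fun n w => frobenius_norm (Omstar n w - Om0 n)) 0 ->
  ((p n + s n)%:R ^+ 2 * epsn R (p n) (s n) n @[n --> \oo] --> (0 : R)) ->
  cvg_in_prob_on P (fun n => [set w | regular_model (G n) (Omstar n w)])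
    (fun n w => laplace_ratio (G n) n lambda
       (sample_cov (fun i => X n i w)) (Omstar n w)) 1.
Proof.
move=> e0 l0 p0 uc _ _ Gs gl _ cvO cvE dev dev0.
(* This bounds the diagonal of [Omstar] at Frobenius distance at most 1: the diagonal of [Om0] is at
   most its eigenvalue bound [eps0^-1], and entries move by at most 1. *)
have C0 : 0 <= eps0^-1 + 1 by rewrite addr_ge0// invr_ge0 ltW.
have [kappa k0 HK] := laplace_ratio_cvg1 l0 C0 dev0.
have p1 n : p n = 1%N -> s n = 0%N.
  rewrite -Gs; move: (G n) => Gn pn; move: Gn; rewrite pn => Gn.
  exact: model1_card.
have Hn := sum_cube_le p0 p1 k0 cvE.
have cvO1 := cvO 1 ltr01.
apply: (squeeze_cvge _ (cvg_cst _) cvO1).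
near=> n; rewrite outer_measure_ge0/=; apply: le_outer_measure.
have n0 : (0 < n)%N by near: n; exists 1%N.
have Mn : (p n + #|G n|)%:R ^+ 3 <= kappa * n%:R.
  by rewrite Gs; near: n.
move=> w [_ /= bad]; split => //=; rewrite ltNge; apply/negP => O1.
move: bad; rewrite ltNge => /negP; apply; apply: HK => //; first exact: gl.
move=> i; have [_ _ ev] := uc n; have [[sO _] _ _] := uc n.
have h1 : Om0 n i i <= eps0^-1 by apply: eigen_diag_le => // a /ev /andP[].
rewrite subr0 ger0_norm ?sqrtr_ge0// in O1.
have := le_trans (entry_le_frobenius (Omstar n w - Om0 n) i i) O1.
rewrite !mxE ler_norml => /andP[_ h2]; lra.
Unshelve. all: by end_near. Qed.
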